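(* Let $R>r>0$, let $\mathcal{T}\subset\mathbb{R}^3$ be the torus with radii $R,r$, and let $d\ge 0$ be a fixed integer. Let $\{X_h\}$ be a family of finite node sets on $\mathcal{T}$, where $h=h_{X_h,\mathcal{T}}$ is the fill distance and $h\to0$, with families of unisolvent stencils $\Sigma_h=\{\sigma_{1,h},\ldots,\sigma_{L_h,h}\}$ covering $X_h$. Assume that there exist constants $C_H,C_\sigma,\Lambda>0$, independent of $h$, and numbers $H_h$ such that $$h<H_h\le C_Hh,\qquad \max_{1\le j\le L_h}\operatorname{diam}_E(\sigma_{j,h})\le C_\sigma h,\qquad \Lambda_h\le\Lambda .$$ If the support radii are chosen as $R_{j,h}=\operatorname{diam}_E(\sigma_{j,h})+H_h$, then there is a constant $C$, independent of $h$, $\mu$ and $f$, such that for every $\mu>0$ and every $f\in C^{d+1}(\mathcal{T})$, $$\|f-\widetilde{\mathcal{M}}_{\mu,h}[f]\|_{L^\infty(\mathcal{T})}\le C\,h^{d+1}\,\|f\|_{C^{d+1}(\mathcal{T})}$$ for all sufficiently small $h$.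
   Context: For $R>r>0$, the torus is $\mathcal{T}=\{(x,y,z)\in\mathbb{R}^3:(\sqrt{x^2+y^2}-R)^2+z^2=r^2\}$, parametrized by $\Phi(\theta,\phi)=((R+r\cos\theta)\cos\phi,(R+r\cos\theta)\sin\phi,r\sin\theta)$, viewed as a map $\mathbb{R}^2/(2\pi\mathbb{Z})^2\to\mathcal{T}$. $\mathcal{H}_d(\mathcal{T})=\{p|_{\mathcal{T}}:p\text{ a real polynomial in }x,y,z\text{ of total degree}\le d\}$ and $m_d=\dim\mathcal{H}_d(\mathcal{T})$. A set of $m_d$ distinct points of $\mathcal{T}$ is unisolvent for $\mathcal{H}_d(\mathcal{T})$ if for arbitrary prescribed real values at these points there is exactly one element of $\mathcal{H}_d(\mathcal{T})$ taking these values. $d_E(\boldsymbol{x},\boldsymbol{y})=\|\boldsymbol{x}-\boldsymbol{y}\|_2$ and $\operatorname{diam}_E(\sigma)=\max_{\boldsymbol{x},\boldsymbol{y}\in\sigma}d_E(\boldsymbol{x},\boldsymbol{y})$. Norm: $\|f\|_{C^k(\mathcal{T})}=\max_{|\alpha|\le k}\|\partial^\alpha(f\circ\Phi)\|_{L^\infty([0,2\pi]^2)}$, with $f\circ\Phi$ identified with its $2\pi$-periodic lift to $\mathbb{R}^2$. The $L^\infty(\mathcal{T})$ norm is the supremum over $\mathcal{T}$. Family of operators. $\{X_h\}$ is a family of finite sets of pairwise distinct nodes on $\mathcal{T}$ indexed by the fill distance $h=h_{X_h,\mathcal{T}}=\sup_{\boldsymbol{x}\in\mathcal{T}}\min_{\boldsymbol{\xi}\in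 X_h}d_E(\boldsymbol{x},\boldsymbol{\xi})$. For each $h$, $\Sigma_h=\{\sigma_{1,h},\ldots,\sigma_{L_h,h}\}$ is a family of stencils $\sigma_{j,h}=\{\boldsymbol{x}_{j_1,h},\ldots,\boldsymbol{x}_{j_{m_d},h}\}\subset X_h$, each unisolvent for $\mathcal{H}_d(\mathcal{T})$, with $X_h=\bigcup_j\sigma_{j,h}$. $P_{j,h}[f]\in\mathcal{H}_d(\mathcal{T})$ is the unique interpolant of $f$ on $\sigma_{j,h}$, and $\ell_{j_1,h},\ldots,\ell_{j_{m_d},h}\in\mathcal{H}_d(\mathcal{T})$ are the fundamental polynomials, $\ell_{j_k,h}(\boldsymbol{x}_{j_\ell,h})=\delta_{k\ell}$. With support radii $R_{j,h}>0$ and $\mu>0$, for $\boldsymbol{x}\in\mathcal{T}\setminus X_h$ set $$\omega_{\mu,j,h}(\boldsymbol{x})=\prod_{\ell=1}^{m_d}\left(\frac{1}{d_E(\boldsymbol{x},\boldsymbol{x}_{j_\ell,h})}-\frac{1}{R_{j,h}}\right)_+^{\mu},\qquad(t)_+=\max\{t,0\}.$$ Let $C_{j,h}=\bigcap_{\ell=1}^{m_d}\{\boldsymbol{\xi}\in\mathcal{T}:d_E(\boldsymbol{\xi},\boldsymbol{x}_{j_\ell,h})\le R_{j,h}\}$ and, for $\boldsymbol{x}\in\mathcal{T}$, $J_{\boldsymbol{x},h}=\{j:\boldsymbol{x}\in\text{interior of }C_{j,h}\text{ in }\mathcal{T}\}$. The normalized weights are $\widetilde W_{\mu,j,h}(\boldsymbol{x})=\omega_{\mu,j,h}(\boldsymbol{x})/\sum_{k\in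 J_{\boldsymbol{x},h}}\omega_{\mu,k,h}(\boldsymbol{x})$ for $j\in J_{\boldsymbol{x},h}$, and $0$ otherwise (with the radii $R_{j,h}=\operatorname{diam}_E(\sigma_{j,h})+H_h$, $H_h>h$, the sets $J_{\boldsymbol{x},h}$ are non-empty and the denominators are strictly positive). The compactly supported multinode Shepard operator is $$\widetilde{\mathcal{M}}_{\mu,h}[f](\boldsymbol{x})=\begin{cases}\displaystyle\sum_{j\in J_{\boldsymbol{x},h}}\widetilde W_{\mu,j,h}(\boldsymbol{x})P_{j,h}[f](\boldsymbol{x}),&\boldsymbol{x}\in\mathcal{T}\setminus X_h,\\ f(\boldsymbol{x}),&\boldsymbol{x}\in X_h.\end{cases}$$ Local stability factor: $\displaystyle\Lambda_h=\sup_{\boldsymbol{x}\in\mathcal{T}}\ \max_{j\in J_{\boldsymbol{x},h}}\ \sum_{k=1}^{m_d}|\ell_{j_k,h}(\boldsymbol{x})|$. *)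

(* Defs.v *)
(* Functions on the torus are represented by functions on the ambient space
   whose values off the torus are never used: equality, uniqueness and linear
   independence in H_d(T) are all taken modulo equality on T. *)
From Stdlib Require Import Reals List Arith ClassicalEpsilon.
From Coquelicot Require Import Coquelicot.
Import ListNotations.
Open Scope R_scope.

Definition point : Type := (R * R * R)%type.
Definition cx (p : point) : R := fst (fst p).
Definition cy (p : point) : R := snd (fst p).
Definition cz (p : point) : R := snd p.

Definition dE (p q : point) : R :=
  sqrt ((cx p - cx q) ^ 2 + (cy p - cy q) ^ 2 + (cz p - cz q) ^ 2).

Definition torus (Rt r : R) (p : point) : Prop :=
  (sqrt (cx p ^ 2 + cy p ^ 2) - Rt) ^ 2 + cz p ^ 2 = r ^ 2.

Definition Phi (Rt r theta phi : R) : point :=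
  ((Rt + r * cos theta) * cos phi, (Rt + r * cos theta) * sin phi,
   r * sin theta).

Definition Rsum (s : list R) : R := fold_right Rplus 0 s.
Definition Rprod (s : list R) : R := fold_right Rmult 1 s.
(* The default value 0 is harmless: only used on lists of nonnegative reals. *)
Definition Rmaxl (s : list R) : R := fold_right Rmax 0 s.

Definition Rbar_max (a b : Rbar) : Rbar := if Rbar_le_dec a b then b else a.
Definition Rbar_maxl (s : list Rbar) : Rbar := fold_right Rbar_max (Finite 0) s.

(* Extended-real valued, so that an unbounded function has norm +oo. *)
Definition sup_norm {A : Type} (D : A -> Prop) (g : A -> R) : Rbar :=
  Lub_Rbar (fun t => exists a, D a /\ t = Rabs (g a)).

(* x^i y^j z^k ranges over i + j + k <= d; recall that [sum_f_R0 u n] has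
   n + 1 terms. *)
Definition poly3 (d : nat) (c : nat -> nat -> nat -> R) (p : point) : R :=
  sum_f_R0 (fun i =>
    sum_f_R0 (fun j =>
      sum_f_R0 (fun k => c i j k * cx p ^ i * cy p ^ j * cz p ^ k)
        (d - i - j))
      (d - i))
    d.

Definition Hd (T : point -> Prop) (d : nat) (p : point -> R) : Prop :=
  exists c, forall x, T x -> p x = poly3 d c x.

Definition is_basis_on (T : point -> Prop) (V : (point -> R) -> Prop) (m : nat)
    (b : nat -> point -> R) : Prop :=
  let comb (c : nat -> R) (x : point) :=
    Rsum (map (fun i => c i * b i x) (seq 0 m)) in
  (forall i, (i < m)%nat -> V (b i)) /\
  (forall p, V p -> exists c, forall x, T x -> p x = comb c x) /\
  (forall c, (forall x, T x -> comb c x = 0) ->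
     forall i, (i < m)%nat -> c i = 0).

(* The cardinality of a basis; meaningful since H_d(T) is finite-dimensional. *)
Definition dimHd (T : point -> Prop) (d : nat) : nat :=
  epsilon (inhabits 0%nat) (fun m => exists b, is_basis_on T (Hd T d) m b).

Definition unisolvent (T : point -> Prop) (d : nat) (s : list point) : Prop :=
  NoDup s /\ (forall x, In x s -> T x) /\ length s = dimHd T d /\
  forall v : point -> R,
    exists p, (Hd T d p /\ (forall x, In x s -> p x = v x)) /\
      forall q, Hd T d q -> (forall x, In x s -> q x = v x) ->
        forall x, T x -> q x = p x.

Definition interpolant (T : point -> Prop) (d : nat) (s : list point)
    (f : point -> R) : point -> R :=
  epsilon (inhabits (fun _ => 0))
    (fun p => Hd T d p /\ forall x, In x s -> p x = f x).

(* The fundamental polynomial of the stencil s attached to its node xi. *)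
Definition fundamental (T : point -> Prop) (d : nat) (s : list point)
    (xi : point) : point -> R :=
  epsilon (inhabits (fun _ => 0))
    (fun p => Hd T d p /\ p xi = 1 /\
       forall eta, In eta s -> eta <> xi -> p eta = 0).

Definition diam (s : list point) : R :=
  Rmaxl (map (fun pq => dE (fst pq) (snd pq)) (list_prod s s)).

(* On an empty X the minimum does not exist and this is -oo, so the equation
   [fill_distance T X = Finite h] forces X to be nonempty. *)
Definition fill_distance (T : point -> Prop) (X : list point) : Rbar :=
  Lub_Rbar (fun t => exists x, T x /\
    (exists xi, In xi X /\ t = dE x xi) /\
    (forall xi, In xi X -> t <= dE x xi)).

(* (t)_+ ^ mu for mu > 0.  The test is needed: Stdlib has Rpower 0 mu = 1. *)
Definition pos_power (t mu : R) : R :=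
  if Rlt_dec 0 t then Rpower t mu else 0.

Definition omega (s : list point) (rho mu : R) (x : point) : R :=
  Rprod (map (fun xi => pos_power (/ dE x xi - / rho) mu) s).

Definition support_set (T : point -> Prop) (s : list point) (rho : R)
    (x : point) : Prop :=
  T x /\ forall xi, In xi s -> dE x xi <= rho.

Definition interior_in (T C : point -> Prop) (x : point) : Prop :=
  T x /\ exists eps, 0 < eps /\ forall y, T y -> dE x y < eps -> C y.

(* J_x, as the increasing list of the active indices j < L; the stencils are
   sigma 0, ..., sigma (L - 1), with support radii rho 0, ..., rho (L - 1). *)
Definition active (T : point -> Prop) (L : nat) (sigma : nat -> list point)
    (rho : nat -> R) (x : point) : list nat :=
  filter (fun j =>
      if excluded_middle_informative
           (interior_in T (support_set T (sigma j) (rho j)) x)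
      then true else false)
    (seq 0 L).

Definition weight (T : point -> Prop) (L : nat) (sigma : nat -> list point)
    (rho : nat -> R) (mu : R) (j : nat) (x : point) : R :=
  if in_dec Nat.eq_dec j (active T L sigma rho x) then
    omega (sigma j) (rho j) mu x /
    Rsum (map (fun k => omega (sigma k) (rho k) mu x) (active T L sigma rho x))
  else 0.

Definition multinode_shepard (T : point -> Prop) (d : nat) (X : list point)
    (L : nat) (sigma : nat -> list point) (rho : nat -> R) (mu : R)
    (f : point -> R) (x : point) : R :=
  if excluded_middle_informative (In x X) then f x
  else Rsum (map (fun j => weight T L sigma rho mu j x *
                           interpolant T d (sigma j) f x)
                 (active T L sigma rho x)).

Definition stability_factor (T : point -> Prop) (d : nat) (L : nat)
    (sigma : nat -> list point) (rho : nat -> R) : Rbar :=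
  Lub_Rbar (fun t => exists x, T x /\
    t = Rmaxl (map (fun j =>
          Rsum (map (fun xi => Rabs (fundamental T d (sigma j) xi x)) (sigma j)))
        (active T L sigma rho x))).

Definition lift (Rt r : R) (f : point -> R) (theta phi : R) : R :=
  f (Phi Rt r theta phi).

(* [ex_diff_n g k] at every point: all iterated partial derivatives of order
   at most k, in any order of differentiation, exist and are continuous. *)
Definition Ck_torus (Rt r : R) (k : nat) (f : point -> R) : Prop :=
  forall theta phi, ex_diff_n (lift Rt r f) k theta phi.

Definition multi_indices (k : nat) : list (nat * nat) :=
  filter (fun a => (fst a + snd a <=? k)%nat)
    (list_prod (seq 0 (S k)) (seq 0 (S k))).

(* The derivatives of a C^k function being continuous, their essential
   suprema over the square [0, 2 pi]^2 are suprema. *)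
Definition Ck_norm (Rt r : R) (k : nat) (f : point -> R) : Rbar :=
  Rbar_maxl (map (fun a =>
      sup_norm
        (fun tp : R * R =>
           0 <= fst tp <= 2 * PI /\ 0 <= snd tp <= 2 * PI)
        (fun tp => partial_derive (fst a) (snd a) (lift Rt r f)
                     (fst tp) (snd tp)))
    (multi_indices k)).

(* Main.v *)
(* Around a point x = Phi(th, ph) of the torus put y = Phi(th + t, ph + s).
   The coordinates u, v of y along the two tangent vectors at x are affine
   functions of y in the ambient space, and u = r t + O(2),
   v = (R + r cos th) s + O(2).  Hence t^a s^b is a multiple of u^a v^b up to
   monomials in t, s of higher degree, and descending induction on a + b
   approximates every t^a s^b by a polynomial of degree <= d in y up to
   O((|t| + |s|)^(d+1)), uniformly in x.  Together with Taylor's formula for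
   f o Phi this gives a P in H_d(T) with |f - P| <= K |f|_{C^{d+1}} dE(x, .)^(d+1)
   on the whole torus, since |t| + |s| = O(dE(x, y)) for |t|, |s| <= pi.
   If j is active at x, all nodes of the stencil lie within
   (Csigma + CH) h of x, and P_j[f] - P interpolates f - P there, so
   |P_j[f](x) - f(x)| <= Lam max |f - P| on the stencil; the weights average
   these errors.  They sum to 1 because the stencil containing a node nearest
   to x is active at x with a positive omega. *)
Require Import Defs.
From Stdlib Require Import Reals List.
From Stdlib Require Import Arith ZArith Lra Lia ClassicalEpsilon.
From Coquelicot Require Import Coquelicot.
Open Scope R_scope.

(** * Taylor's formula with uniform bounds *)

Lemma Rabs_sum_f_R0_le (u : nat -> R) (E : R) (n : nat) :
  (forall i, (i <= n)%nat -> Rabs (u i) <= E) ->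
  Rabs (sum_f_R0 u n) <= INR (S n) * E.
Proof.
intros Hu. induction n as [|n IH].
- simpl. rewrite Rmult_1_l. auto.
- rewrite S_INR. simpl sum_f_R0.
  eapply Rle_trans; [apply Rabs_triang|].
  assert (Rabs (sum_f_R0 u n) <= INR (S n) * E) by (apply IH; auto).
  assert (Rabs (u (S n)) <= E) by auto. lra.
Qed.

Lemma Rabs_div_fact_le (x : R) (k : nat) :
  Rabs (x / INR (fact k)) <= Rabs x.
Proof.
assert (1 <= INR (fact k)) by (apply (le_INR 1), lt_O_fact).
unfold Rdiv. rewrite Rabs_mult, Rabs_inv, (Rabs_pos_eq (INR (fact k))) by lra.
assert (/ INR (fact k) <= 1)
  by (rewrite <- Rinv_1; apply Rinv_le_contravar; lra).
assert (0 <= Rabs x) by apply Rabs_pos. nra.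
Qed.

(** The Lagrange form is applied to [tau -> f (x + t * tau)] on [[0, 1]]: an ordered interval
    whatever the sign of [t], so no case distinction is needed. Each derivative in [tau] brings out
    a factor [t], and the factorial under the remainder is simply dropped. *)
Lemma taylor_bound (f : R -> R) (n : nat) (M x t : R) :
  (forall k y, (k <= S n)%nat -> ex_derive_n f k y) ->
  (forall y, Rabs (Derive_n f (S n) y) <= M) ->
  Rabs (f (x + t)
        - sum_f_R0 (fun k => Derive_n f k x / INR (fact k) * t ^ k) n)
  <= M * Rabs t ^ S n.
Proof.
intros Hex HM.
pose (G := fun z => f (z + x)).
assert (HG : forall k y, (k <= S n)%nat -> ex_derive_n G k y).
{ intros k y Hk. apply ex_derive_n_comp_trans. auto. }
assert (HF : forall k y, (k <= S n)%nat ->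
   Derive_n (fun tau => G (t * tau)) k y = t ^ k * Derive_n f k (t * y + x)).
{ intros k y Hk. rewrite Derive_n_comp_scal.
  - unfold G. now rewrite Derive_n_comp_trans.
  - apply filter_forall. intros z j Hj. apply HG. lia. }
destruct (Taylor_Lagrange (fun tau => G (t * tau)) n 0 1) as [z [_ Hz]].
- lra.
- intros y _ k Hk. apply ex_derive_n_comp_scal.
  apply filter_forall. intros w j Hj. apply HG. lia.
- unfold G at 1 in Hz. rewrite (HF (S n)) in Hz by lia.
  replace (x + t) with (t * 1 + x) by ring. rewrite Hz.
  rewrite (sum_eq _ (fun k => Derive_n f k x / INR (fact k) * t ^ k)).
  2:{ intros i Hi. rewrite HF by lia. replace (t * 0 + x) with x by ring.
      replace (1 - 0) with 1 by ring. rewrite pow1.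
      unfold Rdiv; ring. }
  replace (1 - 0) with 1 by ring. rewrite pow1.
  match goal with |- Rabs (?a + ?b - ?a') <= _ => replace (a + b - a')
    with ((t ^ S n * Derive_n f (S n) (t * z + x)) / INR (fact (S n))) end.
  2:{ unfold Rdiv; ring. }
  eapply Rle_trans; [apply Rabs_div_fact_le|].
  rewrite Rabs_mult, <- RPow_abs, Rmult_comm.
  apply Rmult_le_compat_r; [apply pow_le, Rabs_pos|auto].
Qed.

(** Each differentiation uses up one level of [ex_diff_n]; the induction moves one unit from [n] to
    [b] and reads off the component on the derivative in the second variable. *)
Lemma ex_diff_n_Derive_n_r (f : R -> R -> R) (b n : nat) :
  (forall x y, ex_diff_n f (b + n) x y) ->
  forall x y, ex_diff_n (fun u v => Derive_n (fun z => f u z) b v) n x y.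
Proof.
revert n. induction b as [|b IH]; intros n Hf x y; [apply Hf|].
assert (H : forall x y, ex_diff_n (fun u v => Derive_n (fun z => f u z) b v) (S n) x y).
{ apply IH. intros. replace (b + S n)%nat with (S b + n)%nat by lia. apply Hf. }
destruct (H x y) as [_ [_ [_ [_ H']]]]. exact H'.
Qed.

Lemma ex_diff_n_Derive_n_l (f : R -> R -> R) (a n : nat) :
  (forall x y, ex_diff_n f (a + n) x y) ->
  forall x y, ex_diff_n (fun u v => Derive_n (fun z => f z v) a u) n x y.
Proof.
revert n. induction a as [|a IH]; intros n Hf x y; [apply Hf|].
assert (H : forall x y, ex_diff_n (fun u v => Derive_n (fun z => f z v) a u) (S n) x y).
{ apply IH. intros. replace (a + S n)%nat with (S a + n)%nat by lia. apply Hf. }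
destruct (H x y) as [_ [_ [_ [H' _]]]]. exact H'.
Qed.

Lemma ex_diff_n_ex_derive_n_r (f : R -> R -> R) (n : nat) :
  (forall x y, ex_diff_n f n x y) ->
  forall b x y, (b <= n)%nat -> ex_derive_n (fun z => f x z) b y.
Proof.
intros Hf [|b] x y Hb; [exact I|].
destruct (ex_diff_n_Derive_n_r f b (S (n - S b))) with (x := x) (y := y)
  as [_ [_ [H _]]]; [|exact H].
intros. replace (b + S (n - S b))%nat with n by lia. auto.
Qed.

Lemma ex_diff_n_ex_derive_n_l (f : R -> R -> R) (n : nat) :
  (forall x y, ex_diff_n f n x y) ->
  forall a x y, (a <= n)%nat -> ex_derive_n (fun z => f z y) a x.
Proof.
intros Hf [|a] x y Ha; [exact I|].
destruct (ex_diff_n_Derive_n_l f a (S (n - S a))) with (x := x) (y := y)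
  as [_ [H _]]; [|exact H].
intros. replace (a + S (n - S a))%nat with n by lia. auto.
Qed.

(* Expanding in the second variable first only involves the derivatives
   [partial_derive a b], so no symmetry of mixed derivatives is needed. *)
Lemma taylor_bound_2d (g : R -> R -> R) (d : nat) (M x y t s : R) :
  (forall x y, ex_diff_n g (S d) x y) ->
  (forall a b x y, (a + b <= S d)%nat ->
     Rabs (partial_derive a b g x y) <= M) ->
  Rabs (g (x + t) (y + s)
        - sum_f_R0 (fun b =>
            sum_f_R0 (fun a =>
              partial_derive a b g x y / INR (fact a) / INR (fact b)
              * (t ^ a * s ^ b)) (d - b)) d)
  <= INR (S (S d)) * M * (Rabs t + Rabs s) ^ S d.
Proof.
intros Hg HM.
assert (HM0 : 0 <= M).
{ eapply Rle_trans; [apply Rabs_pos|apply (HM 0%nat 0%nat 0 0); lia]. }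
assert (Ht := Rabs_pos t). assert (Hs := Rabs_pos s).
set (del := Rabs t + Rabs s).
(* [S1] expands in [s] alone, with coefficients still taken at [x + t]. Replacing each of its
   [d + 1] coefficients by a Taylor polynomial in [t] of degree [d - b] costs at most
   [M * del ^ S d]; with the error of [S1] itself this makes the factor [d + 2]. *)
pose (S1 := sum_f_R0 (fun b =>
  Derive_n (fun z => g (x + t) z) b y / INR (fact b) * s ^ b) d).
match goal with |- Rabs (_ - ?S) <= _ => set (S2 := S) end.
replace (g (x + t) (y + s) - S2)
  with ((g (x + t) (y + s) - S1) + (S1 - S2)) by ring.
eapply Rle_trans; [apply Rabs_triang|].
rewrite (S_INR (S d)).
assert (H1 : Rabs (g (x + t) (y + s) - S1) <= M * del ^ S d).
{ eapply Rle_trans.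
  - apply (taylor_bound (fun z => g (x + t) z) d M).
    + intros. apply (ex_diff_n_ex_derive_n_r g (S d)); auto.
    + intros w. apply (HM 0%nat (S d) (x + t) w). lia.
  - apply Rmult_le_compat_l; [easy|]. apply pow_incr. unfold del; lra. }
enough (H2 : Rabs (S1 - S2) <= INR (S d) * (M * del ^ S d)) by lra.
unfold S1, S2. rewrite <- minus_sum. apply Rabs_sum_f_R0_le. intros b Hb.
pose (G := fun u => Derive_n (fun z => g u z) b y).
assert (HG : Rabs (G (x + t) - sum_f_R0 (fun a =>
    Derive_n G a x / INR (fact a) * t ^ a) (d - b)) <= M * Rabs t ^ S (d - b)).
{ apply taylor_bound.
  - intros a w Ha.
    apply (ex_diff_n_ex_derive_n_l
             (fun u v => Derive_n (fun z => g u z) b v) (S (d - b))); [|easy].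
    apply ex_diff_n_Derive_n_r.
    replace (b + S (d - b))%nat with (S d) by lia. auto.
  - intros w. apply (HM (S (d - b)) b w y). lia. }
fold (G (x + t)).
rewrite (sum_eq _ (fun a => Derive_n G a x / INR (fact a) * t ^ a * (s ^ b / INR (fact b)))).
2:{ intros a _. unfold partial_derive, G, Rdiv. ring. }
rewrite <- scal_sum.
match goal with |- Rabs (_ - _ * ?A) <= _ =>
  replace (G (x + t) / INR (fact b) * s ^ b - s ^ b / INR (fact b) * A)
  with ((G (x + t) - A) * s ^ b / INR (fact b)) by (unfold Rdiv; ring) end.
eapply Rle_trans; [apply Rabs_div_fact_le|].
rewrite Rabs_mult, <- RPow_abs.
replace (S d) with (S (d - b) + b)%nat by lia. rewrite pow_add, <- Rmult_assoc.
apply Rmult_le_compat; [apply Rabs_pos|apply pow_le; easy| |apply pow_incr; unfold del; lra].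
eapply Rle_trans; [exact HG|].
apply Rmult_le_compat_l; [easy|]. apply pow_incr. unfold del; lra.
Qed.

(** * Polynomials in the ambient coordinates *)

(** Describing polynomials by closure rules instead of coefficient arrays makes products and powers
    easy, by induction on derivations. The rule [poly_le_ext] makes pointwise equal functions
    interchangeable. *)
Inductive poly_le (d : nat) : (point -> R) -> Prop :=
| poly_le_monom i j k c : (i + j + k <= d)%nat ->
    poly_le d (fun p => c * (cx p ^ i * cy p ^ j * cz p ^ k))
| poly_le_add F G : poly_le d F -> poly_le d G ->
    poly_le d (fun p => F p + G p)
| poly_le_ext F G : (forall p, F p = G p) -> poly_le d F -> poly_le d G.

Lemma poly_le_weaken (d e : nat) (F : point -> R) :
  (d <= e)%nat -> poly_le d F -> poly_le e F.
Proof.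
intros Hde HF. induction HF as [i j k c H|F G _ IHF _ IHG|F G H _ IH].
- apply poly_le_monom. lia.
- now apply poly_le_add.
- now apply poly_le_ext with F.
Qed.

Lemma poly_le_mul (d e : nat) (F G : point -> R) :
  poly_le d F -> poly_le e G -> poly_le (d + e) (fun p => F p * G p).
Proof.
intros HF HG. induction HF as [i j k c H|F F' _ IHF _ IHF'|F F' H _ IH].
- induction HG as [i' j' k' c' H'|G G' _ IHG _ IHG'|G G' H' _ IH].
  + apply poly_le_ext with (fun p => (c * c') *
      (cx p ^ (i + i') * cy p ^ (j + j') * cz p ^ (k + k'))).
    * intros p. rewrite !pow_add. ring.
    * apply poly_le_monom. lia.
  + eapply poly_le_ext; [|exact (poly_le_add _ _ _ IHG IHG')].
    intros p. simpl. ring.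
  + eapply poly_le_ext; [|exact IH]. intros p. simpl. now rewrite H'.
- eapply poly_le_ext; [|exact (poly_le_add _ _ _ IHF IHF')].
  intros p. simpl. ring.
- eapply poly_le_ext; [|exact IH]. intros p. simpl. now rewrite H.
Qed.

Lemma poly_le_const (d : nat) (c : R) : poly_le d (fun _ => c).
Proof.
eapply poly_le_ext; [|apply (poly_le_monom d 0 0 0 c); lia].
intros p. simpl. ring.
Qed.

Lemma poly_le_scal (d : nat) (c : R) (F : point -> R) :
  poly_le d F -> poly_le d (fun p => c * F p).
Proof. apply (poly_le_mul 0 d (fun _ => c)), poly_le_const. Qed.

Lemma poly_le_pow (F : point -> R) (n : nat) :
  poly_le 1 F -> poly_le n (fun p => F p ^ n).
Proof.
intros HF. induction n as [|n IH].
- apply (poly_le_const 0 1).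
- apply (poly_le_mul 1 n); auto.
Qed.

Lemma poly_le_affine (a b c e : R) :
  poly_le 1 (fun p => a * cx p + b * cy p + c * cz p + e).
Proof.
repeat apply poly_le_add; [| | |apply poly_le_const].
- apply poly_le_ext with (2 := poly_le_monom 1 1 0 0 a (le_n _)).
  intros p. simpl. ring.
- apply poly_le_ext with (2 := poly_le_monom 1 0 1 0 b (le_n _)).
  intros p. simpl. ring.
- apply poly_le_ext with (2 := poly_le_monom 1 0 0 1 c (le_n _)).
  intros p. simpl. ring.
Qed.

Lemma sum_f_R0_delta (g : nat -> R) (a n : nat) : (a <= n)%nat ->
  (forall i, i <> a -> g i = 0) -> sum_f_R0 g n = g a.
Proof.
intros Ha Hg. induction n as [|n IH].
- now replace a with 0%nat by lia.
- simpl. destruct (Nat.eq_dec a (S n)) as [->|Hn].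
  + rewrite (sum_eq _ (fun _ => 0)) by (intros; apply Hg; lia).
    rewrite sum_cte. ring.
  + rewrite IH, (Hg (S n)) by lia. ring.
Qed.

Lemma poly3_add (d : nat) (c c' : nat -> nat -> nat -> R) (p : point) :
  poly3 d (fun i j k => c i j k + c' i j k) p = poly3 d c p + poly3 d c' p.
Proof.
unfold poly3. rewrite <- sum_plus. apply sum_eq. intros i _.
rewrite <- sum_plus. apply sum_eq. intros j _.
rewrite <- sum_plus. apply sum_eq. intros k _. ring.
Qed.

Lemma poly3_scal (d : nat) (a : R) (c : nat -> nat -> nat -> R) (p : point) :
  poly3 d (fun i j k => a * c i j k) p = a * poly3 d c p.
Proof.
unfold poly3. rewrite scal_sum. apply sum_eq. intros i _.
rewrite Rmult_comm, scal_sum. apply sum_eq. intros j _.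
rewrite Rmult_comm, scal_sum. apply sum_eq. intros k _. ring.
Qed.

Lemma poly_le_poly3 (d : nat) (F : point -> R) :
  poly_le d F -> exists c, forall p, F p = poly3 d c p.
Proof.
intros HF. induction HF as [i j k c H|F G _ [c IHF] _ [c' IHG]|F G H _ [c IH]].
(* A monomial has a coefficient array supported at one index. The bound on [i + j + k] puts this
   index within the range of all three nested sums. *)
- exists (fun i' j' k' => if Nat.eq_dec i' i then if Nat.eq_dec j' j then
            if Nat.eq_dec k' k then c else 0 else 0 else 0).
  intros p. unfold poly3.
  rewrite (sum_f_R0_delta _ i); [|lia|].
  1: rewrite (sum_f_R0_delta _ j); [|lia|].
  1: rewrite (sum_f_R0_delta _ k); [|lia|].
  + destruct (Nat.eq_dec i i), (Nat.eq_dec j j), (Nat.eq_dec k k); try easy.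
    ring.
  + intros k' Hk. destruct (Nat.eq_dec i i), (Nat.eq_dec j j), (Nat.eq_dec k' k);
      try easy; ring.
  + intros j' Hj. rewrite (sum_eq _ (fun _ => 0)).
    * rewrite sum_cte. ring.
    * intros k' _. destruct (Nat.eq_dec i i), (Nat.eq_dec j' j); try easy; ring.
  + intros i' Hi. rewrite (sum_eq _ (fun _ => 0)).
    * rewrite sum_cte. ring.
    * intros j' _. rewrite (sum_eq _ (fun _ => 0)).
      -- rewrite sum_cte. ring.
      -- intros k' _. destruct (Nat.eq_dec i' i); try easy; ring.
- exists (fun i j k => c i j k + c' i j k). intros p.
  now rewrite poly3_add, IHF, IHG.
- exists c. intros p. now rewrite <- H.
Qed.

Lemma poly_le_Hd (T : point -> Prop) (d : nat) (F : point -> R) :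
  poly_le d F -> Hd T d F.
Proof.
intros HF. destruct (poly_le_poly3 d F HF) as [c Hc]. exists c. auto.
Qed.

(** * Jets in the angular increments *)

(* Families of functions of [(t, s)], depending on a base angle [th], that
   agree with polynomials in [(t, s)] without terms of degree less than [k],
   up to a remainder of order [d + 1], uniformly in [th].  The box only has to
   contain [[-PI, PI] x [-PI, PI]]. *)
Inductive jet (d k : nat) : (R -> R -> R -> R) -> Prop :=
| jet_monom a b c K : (k <= a + b)%nat -> (forall th, Rabs (c th) <= K) ->
    jet d k (fun th t s => c th * (t ^ a * s ^ b))
| jet_rem F K :
    (forall th t s, Rabs t <= 4 -> Rabs s <= 4 ->
       Rabs (F th t s) <= K * (Rabs t + Rabs s) ^ S d) ->
    jet d k F
| jet_add F G : jet d k F -> jet d k G ->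
    jet d k (fun th t s => F th t s + G th t s)
| jet_ext F G : (forall th t s, F th t s = G th t s) ->
    jet d k F -> jet d k G.

Lemma monom_bound (a b : nat) (t s : R) :
  Rabs (t ^ a * s ^ b) <= (Rabs t + Rabs s) ^ (a + b).
Proof.
assert (Ht := Rabs_pos t). assert (Hs := Rabs_pos s).
rewrite Rabs_mult, <- !RPow_abs, pow_add.
apply Rmult_le_compat; try apply pow_le; try easy; apply pow_incr; lra.
Qed.

(** This is what makes a remainder times a jet a remainder again. The [8] in the proof bounds
    [Rabs t + Rabs s] on the box. *)
Lemma jet_bounded (d k : nat) (F : R -> R -> R -> R) : jet d k F ->
  exists B, forall th t s, Rabs t <= 4 -> Rabs s <= 4 -> Rabs (F th t s) <= B.
Proof.
intros HF.
induction HF as [a b c K H Hc|F K H|F G _ [B HB] _ [B' HB']|F G H _ [B HB]].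
- exists (K * 8 ^ (a + b)). intros th t s Ht Hs. rewrite Rabs_mult.
  apply Rmult_le_compat; try apply Rabs_pos; [easy|].
  eapply Rle_trans; [apply monom_bound|]. apply pow_incr.
  assert (Ht' := Rabs_pos t). assert (Hs' := Rabs_pos s). lra.
- exists (Rabs K * 8 ^ S d). intros th t s Ht Hs.
  eapply Rle_trans; [apply H; easy|].
  assert (Ht' := Rabs_pos t). assert (Hs' := Rabs_pos s).
  eapply Rle_trans;
    [apply Rmult_le_compat_r; [apply pow_le; lra|apply Rle_abs]|].
  apply Rmult_le_compat_l; [apply Rabs_pos|]. apply pow_incr. lra.
- exists (B + B'). intros. eapply Rle_trans; [apply Rabs_triang|].
  apply Rplus_le_compat; auto.
- exists B. intros. rewrite <- H. auto.
Qed.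

(** A remainder of order [d + 1] counts as a jet of any order, hence the arbitrary [k]. *)
Lemma jet_rem_mul (d k l : nat) (F G : R -> R -> R -> R) (K : R) :
  (forall th t s, Rabs t <= 4 -> Rabs s <= 4 ->
     Rabs (F th t s) <= K * (Rabs t + Rabs s) ^ S d) ->
  jet d l G -> jet d k (fun th t s => F th t s * G th t s).
Proof.
intros HF HG. destruct (jet_bounded _ _ _ HG) as [B HB].
apply jet_rem with (K * B). intros th t s Ht Hs.
rewrite Rabs_mult.
replace (K * B * (Rabs t + Rabs s) ^ S d)
  with (K * (Rabs t + Rabs s) ^ S d * B) by ring.
apply Rmult_le_compat; try apply Rabs_pos; auto.
Qed.

Lemma jet_mul (d k l : nat) (F G : R -> R -> R -> R) :
  jet d k F -> jet d l G -> jet d (k + l) (fun th t s => F th t s * G th t s).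
Proof.
intros HF HG.
induction HF as [a b c K H Hc|F K H|F F' _ IH _ IH'|F F' H _ IH].
- induction HG as [a' b' c' K' H' Hc'|G K' H'|G G' _ IH _ IH'|G G' H' _ IH].
  + apply jet_ext with (fun th t s =>
      (c th * c' th) * (t ^ (a + a') * s ^ (b + b'))).
    * intros. rewrite !pow_add. ring.
    * apply jet_monom with (K * K'); [lia|]. intros th. rewrite Rabs_mult.
      apply Rmult_le_compat; try apply Rabs_pos; auto.
  + eapply jet_ext; [|apply (jet_rem_mul d (k + l) k G
      (fun th t s => c th * (t ^ a * s ^ b)) K' H')].
    * intros. simpl. ring.
    * now apply jet_monom with K.
  + eapply jet_ext; [|exact (jet_add _ _ _ _ IH IH')]. intros; simpl; ring.
  + eapply jet_ext; [|exact IH]. intros; simpl. now rewrite H'.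
- now apply jet_rem_mul with l K.
- eapply jet_ext; [|exact (jet_add _ _ _ _ IH IH')]. intros; simpl; ring.
- eapply jet_ext; [|exact IH]. intros; simpl. now rewrite H.
Qed.

Lemma jet_coef (d : nat) (c : R -> R) (K : R) :
  (forall th, Rabs (c th) <= K) -> jet d 0 (fun th _ _ => c th).
Proof.
intros Hc. eapply jet_ext; [|apply (jet_monom d 0 0 0 c K); [lia|easy]].
intros; simpl; ring.
Qed.

Lemma jet_scal (d k : nat) (c : R -> R) (K : R) (F : R -> R -> R -> R) :
  (forall th, Rabs (c th) <= K) -> jet d k F ->
  jet d k (fun th t s => c th * F th t s).
Proof. intros Hc. apply (jet_mul d 0 k), (jet_coef d c K Hc). Qed.

Lemma jet_weaken (d k l : nat) (F : R -> R -> R -> R) :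
  (l <= k)%nat -> jet d k F -> jet d l F.
Proof.
intros Hlk HF.
induction HF as [a b c K H Hc|F K H|F G _ IHF _ IHG|F G H _ IH].
- apply jet_monom with K; [lia|easy].
- now apply jet_rem with K.
- now apply jet_add.
- now apply jet_ext with F.
Qed.

Lemma jet_pow (d k n : nat) (F : R -> R -> R -> R) :
  jet d k F -> jet d (n * k) (fun th t s => F th t s ^ n).
Proof.
intros HF. induction n as [|n IH].
- simpl. apply (jet_coef d (fun _ => 1) 1). intros. rewrite Rabs_R1. lra.
- apply (jet_mul d k (n * k)); auto.
Qed.

(** Induction through [F^(n+1) - G^(n+1) = F (F^n - G^n) + (F - G) G^n]: both products gain one
    order over the previous step. *)
Lemma jet_pow_sub (d n : nat) (F G : R -> R -> R -> R) :
  jet d 1 G -> jet d 2 (fun th t s => F th t s - G th t s) ->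
  jet d (S n) (fun th t s => F th t s ^ n - G th t s ^ n).
Proof.
intros HG HFG.
assert (HF : jet d 1 F).
{ eapply jet_ext; [|apply jet_add; [exact HG|
    apply (jet_weaken d 2 1); [lia|exact HFG]]]. intros; simpl; ring. }
induction n as [|n IH].
- apply jet_rem with 0. intros. simpl. rewrite Rminus_diag, Rabs_R0. lra.
- eapply jet_ext; [|apply jet_add;
    [exact (jet_mul _ _ _ _ _ HF IH)|
     replace (S (S n)) with (2 + n * 1)%nat by lia;
     exact (jet_mul _ _ _ _ _ HFG (jet_pow d 1 n _ HG))]].
  intros; simpl; ring.
Qed.

(** Telescoping: the difference is [(F^a - F'^a) G^b + F'^a (G^b - G'^b)]. It shows that changing
    the factors at second order changes a monomial of degree [a + b] only at the next order. *)
Lemma jet_pow_mul_sub (d a b : nat) (F F' G G' : R -> R -> R -> R) :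
  jet d 1 F' -> jet d 2 (fun th t s => F th t s - F' th t s) ->
  jet d 1 G' -> jet d 2 (fun th t s => G th t s - G' th t s) ->
  jet d (S (a + b)) (fun th t s =>
    F th t s ^ a * G th t s ^ b - F' th t s ^ a * G' th t s ^ b).
Proof.
intros HF' HF HG' HG.
assert (HG1 : jet d 1 G).
{ eapply jet_ext; [|apply jet_add; [exact HG'|
    apply (jet_weaken d 2 1); [lia|exact HG]]]. intros; simpl; ring. }
eapply jet_ext; [|apply jet_add;
    [replace (S (a + b)) with (S a + b * 1)%nat by lia;
     exact (jet_mul _ _ _ _ _ (jet_pow_sub d a F F' HF' HF) (jet_pow d 1 b _ HG1))|
     replace (S (a + b)) with (a * 1 + S b)%nat by lia;
     exact (jet_mul _ _ _ _ _ (jet_pow d 1 a _ HF') (jet_pow_sub d b G G' HG' HG))]].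
intros; simpl; ring.
Qed.

(** Transfers to [s] the facts on sine and cosine that are proved for the increment [t]. *)
Lemma jet_swap (d k : nat) (F : R -> R -> R -> R) :
  jet d k F -> jet d k (fun th t s => F th s t).
Proof.
intros HF.
induction HF as [a b c K H Hc|F K H|F G _ IHF _ IHG|F G H _ IH].
- eapply jet_ext; [|apply (jet_monom d k b a c K); [lia|easy]].
  intros; simpl; ring.
- apply jet_rem with K. intros. rewrite (Rplus_comm (Rabs t)). auto.
- now apply jet_add.
- eapply jet_ext; [|exact IH]. intros; simpl; auto.
Qed.

Lemma jet_sum (d k n : nat) (u : nat -> R -> R -> R -> R) :
  (forall i, (i <= n)%nat -> jet d k (u i)) ->
  jet d k (fun th t s => sum_f_R0 (fun i => u i th t s) n).
Proof.
intros Hu. induction n as [|n IH].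
- now apply Hu.
- simpl. apply (jet_add d k (fun th t s => sum_f_R0 (fun i => u i th t s) n)); auto.
Qed.

(** * Jets of sine and cosine *)

Lemma jet_taylor2 (d : nat) (g : R -> R) (M : R) :
  (forall k y, ex_derive_n g k y) -> (forall k y, Rabs (Derive_n g k y) <= M) ->
  jet d 2 (fun _ t _ => g t - (g 0 + Derive g 0 * t)).
Proof.
intros Hex HM.
assert (HM0 : 0 <= M) by (eapply Rle_trans; [apply Rabs_pos|apply (HM 0%nat 0)]).
pose (c := fun k => Derive_n g k 0 / INR (fact k)).
apply jet_ext with (fun (_ t _ : R) =>
  sum_f_R0 (fun i => c (S (S i)) * t ^ S (S i)) d
  + (g t - sum_f_R0 (fun k => c k * t ^ k) (S (S d)))).
{ intros _ t _. rewrite (decomp_sum _ (S (S d))) by lia. simpl pred.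
  rewrite (decomp_sum _ (S d)) by lia. simpl pred.
  replace (c 0%nat) with (g 0) by (unfold c; simpl; field).
  replace (c 1%nat) with (Derive g 0) by (unfold c; change (Derive_n g 1 0) with (Derive g 0);
      simpl fact; simpl INR; field).
  cbv beta. rewrite pow_O, pow_1. ring. }
apply jet_add.
- apply (jet_sum d 2 d (fun i _ t _ => c (S (S i)) * t ^ S (S i))).
  intros i _. eapply jet_ext;
    [|apply (jet_monom d 2 (S (S i)) 0 (fun _ => c (S (S i))) M)]; [|lia|].
  + intros; simpl; ring.
  + intros _. eapply Rle_trans; [apply Rabs_div_fact_le|apply HM].
(* The Taylor polynomial has degree [d + 2], so that it contains the affine part even for [d = 0].
   Its remainder has order [d + 3], and the two surplus factors are bounded on the box. *)
- apply jet_rem with (M * 8 ^ 2). intros _ t s Ht Hs.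
  generalize (taylor_bound g (S (S d)) M 0 t (fun k y _ => Hex k y) (HM _)).
  rewrite Rplus_0_l. intros H. eapply Rle_trans; [exact H|].
  replace (S (S (S d))) with (2 + S d)%nat by lia.
  rewrite pow_add, Rmult_assoc.
  assert (Ht' := Rabs_pos t). assert (Hs' := Rabs_pos s).
  apply Rmult_le_compat_l; [easy|].
  apply Rmult_le_compat; try apply pow_le; try easy; apply pow_incr; lra.
Qed.

(** Differentiation is a shift by a quarter period, which yields existence of all derivatives and
    the common bound 1. *)
Lemma Derive_n_sin_cos (k : nat) (x : R) :
  Derive_n sin k x = sin (x + INR k * (PI / 2)) /\
  Derive_n cos k x = cos (x + INR k * (PI / 2)).
Proof.
revert x. induction k as [|k IH]; intros x.
- simpl. now rewrite Rmult_0_l, Rplus_0_r.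
- split; simpl Derive_n.
  + rewrite (Derive_ext _ (fun x => sin (x + INR k * (PI / 2)))) by apply IH.
    rewrite S_INR, Rmult_plus_distr_r, Rmult_1_l, <- Rplus_assoc.
    rewrite sin_plus, sin_PI2, cos_PI2.
    apply is_derive_unique. auto_derive; [easy|]. ring.
  + rewrite (Derive_ext _ (fun x => cos (x + INR k * (PI / 2)))) by apply IH.
    rewrite S_INR, Rmult_plus_distr_r, Rmult_1_l, <- Rplus_assoc.
    rewrite cos_plus, sin_PI2, cos_PI2.
    apply is_derive_unique. auto_derive; [easy|]. ring.
Qed.

Lemma ex_derive_n_sin (k : nat) (x : R) : ex_derive_n sin k x.
Proof.
destruct k as [|k]; [exact I|].
apply (ex_derive_ext (fun x => sin (x + INR k * (PI / 2)))).
- intros t. symmetry. apply Derive_n_sin_cos.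
- auto_derive; easy.
Qed.

Lemma ex_derive_n_cos (k : nat) (x : R) : ex_derive_n cos k x.
Proof.
destruct k as [|k]; [exact I|].
apply (ex_derive_ext (fun x => cos (x + INR k * (PI / 2)))).
- intros t. symmetry. apply Derive_n_sin_cos.
- auto_derive; easy.
Qed.

Lemma Rabs_sin_le (x : R) : Rabs (sin x) <= 1.
Proof. apply Rabs_le, SIN_bound. Qed.

Lemma Rabs_cos_le (x : R) : Rabs (cos x) <= 1.
Proof. apply Rabs_le, COS_bound. Qed.

Lemma jet_sin (d : nat) : jet d 2 (fun _ t _ => sin t - t).
Proof.
eapply jet_ext; [|apply (jet_taylor2 d sin 1 ex_derive_n_sin)].
- intros th t s. simpl. replace (Derive sin 0) with 1; [rewrite sin_0; ring|].
  symmetry. apply is_derive_unique. auto_derive; [easy|]. rewrite cos_0; ring.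
- intros k y. rewrite (proj1 (Derive_n_sin_cos k y)). apply Rabs_sin_le.
Qed.

Lemma jet_cos (d : nat) : jet d 2 (fun _ t _ => cos t - 1).
Proof.
eapply jet_ext; [|apply (jet_taylor2 d cos 1 ex_derive_n_cos)].
- intros th t s. simpl. replace (Derive cos 0) with 0; [rewrite cos_0; ring|].
  symmetry. apply is_derive_unique. auto_derive; [easy|]. rewrite sin_0; ring.
- intros k y. rewrite (proj2 (Derive_n_sin_cos k y)). apply Rabs_cos_le.
Qed.

Lemma jet_const (d : nat) (c : R) : jet d 0 (fun _ _ _ => c).
Proof. apply (jet_coef d (fun _ => c) (Rabs c)). intros. lra. Qed.

Lemma jet_t (d : nat) : jet d 1 (fun _ t _ => t).
Proof.
eapply jet_ext; [|apply (jet_monom d 1 1 0 (fun _ => 1) 1); [lia|]].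
- intros; simpl; ring.
- intros. rewrite Rabs_R1. lra.
Qed.

Lemma jet_sin1 (d : nat) : jet d 1 (fun _ t _ => sin t).
Proof.
eapply jet_ext; [|apply jet_add; [apply (jet_t d)|
   apply (jet_weaken d 2 1); [lia|apply jet_sin]]].
intros; simpl; ring.
Qed.

Lemma jet_cos_shift (d : nat) :
  jet d 1 (fun th t _ => cos (th + t) - cos th).
Proof.
eapply jet_ext; [|apply jet_add;
  [apply (jet_scal d 1 cos 1 (fun _ t _ => cos t - 1) Rabs_cos_le);
   apply (jet_weaken d 2 1); [lia|apply jet_cos]|
   apply (jet_scal d 1 (fun th => - sin th) 1 (fun _ t _ => sin t));
   [intros; rewrite Rabs_Ropp; apply Rabs_sin_le|apply jet_sin1]]].
intros. simpl. rewrite cos_plus. ring.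
Qed.

(* The coordinates of a point of the torus along the two unit tangent vectors
   at [Phi th ph], as functions of the increments of the angles. *)
Definition tangent_u (Rt r th t s : R) : R :=
  r * sin t + (Rt + r * cos (th + t)) * (1 - cos s) * sin th.
Definition tangent_v (Rt r th t s : R) : R := (Rt + r * cos (th + t)) * sin s.

Lemma jet_tangent_u (Rt r : R) (d : nat) :
  jet d 2 (fun th t s => tangent_u Rt r th t s - r * t).
Proof.
assert (Hg : jet d 0 (fun th t s => Rt + r * cos (th + t))).
{ eapply jet_ext; [|apply jet_add; [apply (jet_const d Rt)|
    apply (jet_mul d 0 0); [apply (jet_const d r)|
    apply jet_add; [apply (jet_coef d cos 1 Rabs_cos_le)|
      apply (jet_weaken d 1 0); [lia|apply (jet_cos_shift d)]]]]].
  intros; simpl; ring. }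
eapply jet_ext; [|apply jet_add;
  [apply (jet_mul d 0 2); [apply (jet_const d r)|apply jet_sin]|
   apply (jet_mul d 0 2); [exact Hg|
   apply (jet_scal d 2 (fun th => - sin th) 1);
     [intros; rewrite Rabs_Ropp; apply Rabs_sin_le|
      apply (jet_swap d 2), jet_cos]]]].
intros. simpl. unfold tangent_u. ring.
Qed.

(** The difference splits as [(Rt + r cos th) (sin s - s) + r (cos (th + t) - cos th) sin s]; the
    second term is a product of two jets of order 1. *)
Lemma jet_tangent_v (Rt r : R) (d : nat) :
  jet d 2 (fun th t s => tangent_v Rt r th t s - (Rt + r * cos th) * s).
Proof.
assert (Hg : jet d 0 (fun th t s => Rt + r * cos th)).
{ apply jet_add; [apply (jet_const d Rt)|].
  apply (jet_mul d 0 0); [apply (jet_const d r)|apply (jet_coef d cos 1 Rabs_cos_le)]. }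
eapply jet_ext; [|apply jet_add;
  [apply (jet_mul d 0 2); [exact Hg|apply (jet_swap d 2), jet_sin]|
   apply (jet_mul d 0 2); [apply (jet_const d r)|
   apply (jet_mul d 1 1); [apply jet_cos_shift|apply (jet_swap d 1), jet_sin1]]]].
intros. simpl. unfold tangent_v. ring.
Qed.

Lemma poly_le_tangent (Rt r th ph : R) :
  exists U V, poly_le 1 U /\ poly_le 1 V /\ forall t s,
    U (Phi Rt r (th + t) (ph + s)) = tangent_u Rt r th t s /\
    V (Phi Rt r (th + t) (ph + s)) = tangent_v Rt r th t s.
Proof.
(* Inner products with the unit tangent vectors of the meridian and of the parallel. The constant
   [Rt * sin th] makes [U] vanish at the base point. By rotational symmetry the resulting functions
   of [t] and [s] do not depend on [ph]. *)
exists (fun p => - cos ph * sin th * cx p + - sin ph * sin th * cy p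
                 + cos th * cz p + Rt * sin th),
       (fun p => - sin ph * cx p + cos ph * cy p + 0 * cz p + 0).
split; [apply poly_le_affine|]. split; [apply poly_le_affine|].
intros t s. unfold Phi, cx, cy, cz, tangent_u, tangent_v. simpl fst. simpl snd.
assert (Hph : sin ph * sin ph = 1 - cos ph * cos ph)
  by (generalize (sin2_cos2 ph); unfold Rsqr; lra).
split.
- replace (sin t) with (sin (th + t - th)) by (f_equal; ring).
  rewrite sin_minus, (cos_plus ph s), (sin_plus ph s).
  set (g := Rt + r * cos (th + t)).
  replace (r * cos (th + t)) with (g - Rt) in * by (unfold g; ring).
  replace (r * (sin (th + t) * cos th - cos (th + t) * sin th))
    with (r * sin (th + t) * cos th - (g - Rt) * sin th) by (unfold g; ring).
  ring_simplify.
  replace (sin ph ^ 2) with (1 - cos ph ^ 2) by lra. ring.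
- rewrite (cos_plus ph s), (sin_plus ph s). ring_simplify.
  replace (sin ph ^ 2) with (1 - cos ph ^ 2) by lra. ring.
Qed.

(** * Approximation of jets by ambient polynomials *)

Definition approx_at (Rt r : R) (d : nat) (th ph E : R) (F : R -> R -> R) :=
  exists P, poly_le d P /\ forall t s, Rabs t <= 4 -> Rabs s <= 4 ->
    Rabs (F t s - P (Phi Rt r (th + t) (ph + s)))
    <= E * (Rabs t + Rabs s) ^ S d.

Definition approximable (Rt r : R) (d : nat) (F : R -> R -> R -> R) : Prop :=
  exists K, forall th ph, approx_at Rt r d th ph K (F th).

Lemma approximable_add (Rt r : R) (d : nat) (F G : R -> R -> R -> R) :
  approximable Rt r d F -> approximable Rt r d G ->
  approximable Rt r d (fun th t s => F th t s + G th t s).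
Proof.
intros [K HF] [K' HG]. exists (K + K'). intros th ph.
destruct (HF th ph) as [P [HP HPF]]. destruct (HG th ph) as [P' [HP' HPG]].
exists (fun p => P p + P' p). split; [now apply poly_le_add|].
intros t s Ht Hs. specialize (HPF t s Ht Hs). specialize (HPG t s Ht Hs).
match goal with |- Rabs (?a + ?b - (?a' + ?b')) <= _ =>
  replace (a + b - (a' + b')) with ((a - a') + (b - b')) by ring end.
eapply Rle_trans; [apply Rabs_triang|]. lra.
Qed.

Lemma approximable_ext (Rt r : R) (d : nat) (F G : R -> R -> R -> R) :
  (forall th t s, F th t s = G th t s) ->
  approximable Rt r d F -> approximable Rt r d G.
Proof.
intros H [K HF]. exists K. intros th ph. destruct (HF th ph) as [P [HP HPF]].
exists P. split; [easy|]. intros. rewrite <- H. auto.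
Qed.

Lemma approximable_rem (Rt r : R) (d : nat) (F : R -> R -> R -> R) (K : R) :
  (forall th t s, Rabs t <= 4 -> Rabs s <= 4 ->
     Rabs (F th t s) <= K * (Rabs t + Rabs s) ^ S d) ->
  approximable Rt r d F.
Proof.
intros H. exists K. intros th ph. exists (fun _ => 0).
split; [apply poly_le_const|]. intros. rewrite Rminus_0_r. auto.
Qed.

(* Descending induction on [k]: the leading part [t ^ a * s ^ b] of a jet
   agrees to higher order with a multiple of [u ^ a * v ^ b], where [u], [v]
   are the tangent coordinates, which are affine in the ambient space. *)
Lemma jet_approximable (Rt r : R) (d m k : nat) (F : R -> R -> R -> R) :
  0 < r -> r < Rt -> (k + m = S d)%nat -> jet d k F -> approximable Rt r d F.
Proof.
intros hr hRr. revert k F. induction m as [|m IHm]; intros k F Hk HF.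
- induction HF as [a b c K H Hc|F K H|F G _ IHF _ IHG|F G H _ IH].
  (* Here [k = d + 1], so the monomial is itself a remainder: its surplus degree [a + b - (d + 1)]
     is absorbed by the size of the box. *)
  + apply approximable_rem with (K * 8 ^ (a + b - S d)). intros th t s Ht Hs.
    assert (Ht' := Rabs_pos t). assert (Hs' := Rabs_pos s).
    rewrite Rabs_mult, Rmult_assoc.
    apply Rmult_le_compat; try apply Rabs_pos; [easy|].
    eapply Rle_trans; [apply monom_bound|].
    replace (a + b)%nat with (a + b - S d + S d)%nat at 1 by lia.
    rewrite pow_add. apply Rmult_le_compat_r; [apply pow_le; lra|].
    apply pow_incr. lra.
  + now apply approximable_rem with K.
  + now apply approximable_add.
  + now apply approximable_ext with F.
- induction HF as [a b c K H Hc|F K H|F G _ IHF _ IHG|F G H _ IH].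
  + destruct (Nat.eq_dec k (a + b)) as [Hab|Hab].
    2:{ apply (IHm (S k)); [lia|]. apply jet_monom with K; [lia|easy]. }
    (* The divisor is the coefficient of [t^a s^b] in the leading part of [u^a v^b]. It is bounded
       away from 0 uniformly in [th] because [Rt + r * cos th >= Rt - r > 0]. *)
    pose (c' := fun th => c th / (r ^ a * (Rt + r * cos th) ^ b)).
    assert (Hpos : forall th, Rt - r <= Rt + r * cos th)
      by (intros th; destruct (COS_bound th); nra).
    assert (Hc' : forall th, Rabs (c' th) <= K / (r ^ a * (Rt - r) ^ b)).
    { intros th. unfold c', Rdiv.
      assert (0 < r ^ a * (Rt - r) ^ b)
        by (apply Rmult_lt_0_compat; apply pow_lt; lra).
      assert (r ^ a * (Rt - r) ^ b <= r ^ a * (Rt + r * cos th) ^ b).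
      { apply Rmult_le_compat_l; [apply pow_le; lra|].
        apply pow_incr. specialize (Hpos th). lra. }
      rewrite Rabs_mult, Rabs_inv, (Rabs_pos_eq (r ^ a * _)) by lra.
      apply Rmult_le_compat; [apply Rabs_pos| |easy|].
      - left. apply Rinv_0_lt_compat. lra.
      - apply Rinv_le_contravar; lra. }
    apply approximable_ext with (fun th t s =>
      c' th * (tangent_u Rt r th t s ^ a * tangent_v Rt r th t s ^ b)
      + - c' th * (tangent_u Rt r th t s ^ a * tangent_v Rt r th t s ^ b
                   - (r * t) ^ a * ((Rt + r * cos th) * s) ^ b)).
    { intros th t s. unfold c'. rewrite !Rpow_mult_distr. field.
      specialize (Hpos th). split; apply pow_nonzero; lra. }
    apply approximable_add.
    (* The term with [u^a v^b] is exactly a polynomial of degree [a + b = k <= d] in the ambient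
       coordinates, so it has no error. *)
    * exists 0. intros th ph.
      destruct (poly_le_tangent Rt r th ph) as [U [V [HU [HV HUV]]]].
      exists (fun p => c' th * (U p ^ a * V p ^ b)). split.
      -- apply poly_le_scal. apply (poly_le_weaken (a + b)); [lia|].
         apply poly_le_mul; now apply poly_le_pow.
      -- intros t s _ _. destruct (HUV t s) as [-> ->].
         rewrite Rminus_diag, Rabs_R0. lra.
    (* What is left is a jet of order [k + 1], since [u] and [v] agree with their linear parts up to
       order 2. *)
    * apply (IHm (S k)); [lia|]. rewrite Hab.
      apply (jet_scal d _ (fun th => - c' th) (K / (r ^ a * (Rt - r) ^ b))).
      { intros. rewrite Rabs_Ropp. auto. }
      apply (jet_pow_mul_sub d a b _ (fun th t s => r * t) _
               (fun th t s => (Rt + r * cos th) * s)).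
      -- apply (jet_mul d 0 1); [apply jet_const|apply jet_t].
      -- apply jet_tangent_u.
      -- apply (jet_mul d 0 1); [|apply (jet_swap d 1), jet_t].
         apply jet_add; [apply jet_const|].
         apply (jet_mul d 0 0); [apply jet_const|apply (jet_coef d cos 1 Rabs_cos_le)].
      -- apply jet_tangent_v.
  + now apply approximable_rem with K.
  + now apply approximable_add.
  + now apply approximable_ext with F.
Qed.

(** Takes the maximum of finitely many constants; it is used once for each of the two exponents of a
    monomial. *)
Lemma common_constant (Q : nat -> R -> Prop) (n : nat) :
  (forall i K K', K <= K' -> Q i K -> Q i K') ->
  (forall i, (i <= n)%nat -> exists K, Q i K) ->
  exists K, 0 <= K /\ forall i, (i <= n)%nat -> Q i K.
Proof.
intros Hmono HQ. induction n as [|n IH].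
- destruct (HQ 0%nat) as [K HK]; [lia|]. exists (Rmax 0 K).
  split; [apply Rmax_l|]. intros i Hi. replace i with 0%nat by lia.
  apply Hmono with (2 := HK), Rmax_r.
- destruct IH as [K [HK0 HK]]; [auto|]. destruct (HQ (S n)) as [K' HK']; [lia|].
  exists (Rmax K K'). split; [eapply Rle_trans; [exact HK0|apply Rmax_l]|].
  intros i Hi. destruct (Nat.eq_dec i (S n)) as [->|Hn].
  + apply Hmono with (2 := HK'), Rmax_r.
  + apply (Hmono i K); [apply Rmax_l|]. apply HK. lia.
Qed.

Lemma approx_at_le (Rt r : R) (d : nat) (th ph E E' : R) (F : R -> R -> R) :
  E <= E' -> approx_at Rt r d th ph E F -> approx_at Rt r d th ph E' F.
Proof.
intros HE [P [HP H]]. exists P. split; [easy|]. intros t s Ht Hs.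
eapply Rle_trans; [now apply H|]. apply Rmult_le_compat_r; [|easy].
assert (Ht' := Rabs_pos t). assert (Hs' := Rabs_pos s). apply pow_le. lra.
Qed.

Lemma approx_at_scal (Rt r : R) (d : nat) (th ph E c M : R) (F : R -> R -> R) :
  0 <= E -> Rabs c <= M -> approx_at Rt r d th ph E F ->
  approx_at Rt r d th ph (M * E) (fun t s => c * F t s).
Proof.
intros HE Hc [P [HP H]]. exists (fun p => c * P p).
split; [now apply poly_le_scal|]. intros t s Ht Hs.
rewrite <- Rmult_minus_distr_l, Rabs_mult, Rmult_assoc.
apply Rmult_le_compat; try apply Rabs_pos; auto.
Qed.

Lemma approx_at_sum (Rt r : R) (d n : nat) (th ph E : R)
    (u : nat -> R -> R -> R) :
  (forall i, (i <= n)%nat -> approx_at Rt r d th ph E (u i)) ->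
  approx_at Rt r d th ph (INR (S n) * E)
    (fun t s => sum_f_R0 (fun i => u i t s) n).
Proof.
intros Hu. induction n as [|n IH].
- apply approx_at_le with E; [simpl; lra|]. now apply Hu.
- destruct IH as [P [HP HPu]]; [auto|]. destruct (Hu (S n)) as [P' [HP' HPu']]; [lia|].
  exists (fun p => P p + P' p). split; [now apply poly_le_add|].
  intros t s Ht Hs. specialize (HPu t s Ht Hs). specialize (HPu' t s Ht Hs).
  rewrite (S_INR (S n)). simpl sum_f_R0.
  match goal with |- Rabs (?a + ?b - (?a' + ?b')) <= _ =>
    replace (a + b - (a' + b')) with ((a - a') + (b - b')) by ring end.
  eapply Rle_trans; [apply Rabs_triang|]. lra.
Qed.

Lemma monom_approx (Rt r : R) (d : nat) : 0 < r -> r < Rt ->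
  exists K, 0 <= K /\ forall b a, (b <= d)%nat -> (a <= d)%nat ->
    forall th ph, approx_at Rt r d th ph K (fun t s => t ^ a * s ^ b).
Proof.
intros hr hRr.
destruct (common_constant (fun b K => forall a, (a <= d)%nat ->
    forall th ph, approx_at Rt r d th ph K (fun t s => t ^ a * s ^ b)) d)
  as [K [HK0 HK]]; [| |exists K; auto].
- intros b K K' HKK' H a Ha th ph. apply approx_at_le with K; auto.
- intros b Hb.
  destruct (common_constant (fun a K =>
    forall th ph, approx_at Rt r d th ph K (fun t s => t ^ a * s ^ b)) d)
    as [K [HK0 HK]]; [| |exists K; auto].
  + intros a K K' HKK' H th ph. apply approx_at_le with K; auto.
  + intros a Ha.
    destruct (jet_approximable Rt r d (S d) 0 (fun th t s => t ^ a * s ^ b))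
      as [K HK]; auto.
    * eapply jet_ext; [|apply (jet_monom d 0 a b (fun _ => 1) 1); [lia|]].
      -- intros; simpl; ring.
      -- intros. rewrite Rabs_R1. lra.
    * exists K. exact HK.
Qed.

Lemma smooth_approx (Rt r : R) (d : nat) : 0 < r -> r < Rt ->
  exists K, 0 <= K /\ forall g M,
    (forall x y, ex_diff_n g (S d) x y) ->
    (forall a b x y, (a + b <= S d)%nat ->
       Rabs (partial_derive a b g x y) <= M) ->
    forall th ph,
      approx_at Rt r d th ph (K * M) (fun t s => g (th + t) (ph + s)).
Proof.
intros hr hRr. destruct (monom_approx Rt r d hr hRr) as [K [HK0 HK]].
assert (Hd0 := pos_INR (S d)).
(* The first summand comes from the Taylor remainder. The second counts at most [(d + 1)^2]
   monomials, each approximated with error [K] and carrying a coefficient of size at most [M]. *)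
exists (INR (S (S d)) + INR (S d) * INR (S d) * K).
split; [generalize (pos_INR (S (S d))); intros; nra|].
intros g M Hg HM th ph.
assert (HM0 : 0 <= M).
{ eapply Rle_trans; [apply Rabs_pos|apply (HM 0%nat 0%nat 0 0); lia]. }
destruct (approx_at_sum Rt r d d th ph (INR (S d) * (M * K))
  (fun b t s => sum_f_R0 (fun a =>
     partial_derive a b g th ph / INR (fact a) / INR (fact b)
     * (t ^ a * s ^ b)) (d - b))) as [P [HP HPg]].
- intros b Hb. apply approx_at_le with (INR (S (d - b)) * (M * K)).
  { apply Rmult_le_compat_r; [nra|]. apply le_INR. lia. }
  apply (approx_at_sum Rt r d (d - b) th ph (M * K) (fun a t s =>
     partial_derive a b g th ph / INR (fact a) / INR (fact b)
     * (t ^ a * s ^ b))).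
  intros a Ha. apply approx_at_scal; [easy| |apply HK; lia].
  eapply Rle_trans; [apply Rabs_div_fact_le|].
  eapply Rle_trans; [apply Rabs_div_fact_le|]. apply HM. lia.
- exists P. split; [easy|]. intros t s Ht Hs. specialize (HPg t s Ht Hs).
  generalize (taylor_bound_2d g d M th ph t s Hg HM). intros HT.
  match type of HT with Rabs (?a - ?b) <= _ => set (S0 := b) in * end.
  replace (g (th + t) (ph + s) - P (Phi Rt r (th + t) (ph + s))) with
    ((g (th + t) (ph + s) - S0) + (S0 - P (Phi Rt r (th + t) (ph + s)))) by ring.
  eapply Rle_trans; [apply Rabs_triang|].
  eapply Rle_trans; [apply Rplus_le_compat; [exact HT|exact HPg]|].
  apply Req_le. ring.
Qed.

(** * Geometry of the torus *)

Lemma unit_circle_angle (a b : R) : a ^ 2 + b ^ 2 = 1 ->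
  exists t, Rabs t <= PI /\ a = cos t /\ b = sin t.
Proof.
intros H. assert (Ha : -1 <= a <= 1) by (split; nra).
assert (Hs : sqrt (1 - a²) = Rabs b).
{ replace (1 - a²) with (b²) by (unfold Rsqr; nra). apply sqrt_Rsqr_abs. }
destruct (acos_bound a) as [H0 H1].
destruct (Rle_dec 0 b) as [Hb|Hb].
- exists (acos a). split; [rewrite Rabs_pos_eq; easy|].
  now rewrite cos_acos, sin_acos, Hs, Rabs_pos_eq by easy.
- exists (- acos a). split; [rewrite Rabs_Ropp, Rabs_pos_eq; easy|].
  rewrite cos_neg, sin_neg, cos_acos, sin_acos, Hs, Rabs_left by lra.
  split; ring.
Qed.

Lemma torus_angles (Rt r : R) (p : point) : 0 < r -> r < Rt ->
  torus Rt r p -> exists th ph, p = Phi Rt r th ph.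
Proof.
intros hr hRr. destruct p as [[x y] z]. unfold torus, cx, cy, cz; simpl fst; simpl snd.
set (w := sqrt (x ^ 2 + y ^ 2)). intros H.
assert (Hw : w ^ 2 = x ^ 2 + y ^ 2) by (apply pow2_sqrt; nra).
(* Since [r < Rt], the torus does not meet the axis, so [ph] can be read from [(x / w, y / w)]. *)
assert (Hw0 : 0 < w) by (assert (0 <= w) by apply sqrt_pos; nra).
destruct (unit_circle_angle ((w - Rt) / r) (z / r)) as [th [_ [Hc Hs]]].
{ apply Rmult_eq_reg_r with (r ^ 2); [|nra].
  rewrite Rmult_1_l. etransitivity; [|exact H]. field. lra. }
destruct (unit_circle_angle (x / w) (y / w)) as [ph [_ [Hc' Hs']]].
{ apply Rmult_eq_reg_r with (w ^ 2); [|nra].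
  rewrite Rmult_1_l. etransitivity; [|symmetry; exact Hw]. field. lra. }
exists th, ph. unfold Phi. rewrite <- Hc, <- Hs, <- Hc', <- Hs'.
f_equal; [f_equal|]; field; lra.
Qed.

(** The increment is the representative of [th - th0] modulo a full turn in [[-PI, PI]]; it lies in
    the box of the jets because [PI <= 4]. *)
Lemma angle_increment (th th0 : R) :
  exists t, Rabs t <= PI /\ cos th = cos (th0 + t) /\ sin th = sin (th0 + t).
Proof.
destruct (unit_circle_angle (cos (th - th0)) (sin (th - th0)))
  as [t [Ht [Hc Hs]]].
{ generalize (sin2_cos2 (th - th0)). unfold Rsqr. lra. }
exists t. split; [easy|].
replace th with (th0 + (th - th0)) at 1 2 by ring.
rewrite !cos_plus, !sin_plus. rewrite <- Hc, <- Hs. easy.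
Qed.

Lemma dE_pos (p q : point) : 0 <= dE p q.
Proof. apply sqrt_pos. Qed.

Lemma dE_sym (p q : point) : dE p q = dE q p.
Proof. unfold dE. f_equal. ring. Qed.

Lemma dE_refl (p : point) : dE p p = 0.
Proof.
unfold dE. rewrite !Rminus_diag.
replace (0 ^ 2 + 0 ^ 2 + 0 ^ 2) with 0 by ring. apply sqrt_0.
Qed.

Lemma dE_eq0 (p q : point) : dE p q = 0 -> p = q.
Proof.
intros H. apply sqrt_eq_0 in H;
  [|repeat apply Rplus_le_le_0_compat; apply pow2_ge_0].
destruct p as [[a b] c], q as [[a' b'] c']. unfold cx, cy, cz in H. simpl fst in H; simpl snd in H.
assert (Hz : forall u v, (u - v) ^ 2 <= 0 -> u = v).
{ intros u v Huv. apply Rminus_diag_uniq.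
  destruct (Req_dec (u - v) 0) as [E|E]; [easy|].
  apply pow2_gt_0 in E. lra. }
generalize (pow2_ge_0 (a - a')) (pow2_ge_0 (b - b')) (pow2_ge_0 (c - c')).
intros. f_equal; [f_equal|]; apply Hz; lra.
Qed.

Lemma dE_triangle (p q w : point) : dE p w <= dE p q + dE q w.
Proof.
destruct p as [[a b] c], q as [[a' b'] c'], w as [[a'' b''] c''].
unfold dE, cx, cy, cz; simpl fst; simpl snd.
set (x1 := a - a'). set (y1 := b - b'). set (z1 := c - c').
set (x2 := a' - a''). set (y2 := b' - b''). set (z2 := c' - c'').
replace (a - a'') with (x1 + x2) by (unfold x1, x2; ring).
replace (b - b'') with (y1 + y2) by (unfold y1, y2; ring).
replace (c - c'') with (z1 + z2) by (unfold z1, z2; ring).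
set (A := x1 ^ 2 + y1 ^ 2 + z1 ^ 2). set (B := x2 ^ 2 + y2 ^ 2 + z2 ^ 2).
assert (HA : 0 <= A) by (unfold A; nra). assert (HB : 0 <= B) by (unfold B; nra).
(* Cauchy-Schwarz through Lagrange's identity: [A * B] exceeds the squared inner product by the
   three squares supplied below. *)
assert (HAB : x1 * x2 + y1 * y2 + z1 * z2 <= sqrt A * sqrt B).
{ rewrite <- sqrt_mult by easy.
  eapply Rle_trans; [apply Rle_abs|]. rewrite <- sqrt_Rsqr_abs.
  apply sqrt_le_1_alt. unfold Rsqr, A, B.
  generalize (pow2_ge_0 (x1 * y2 - y1 * x2)) (pow2_ge_0 (x1 * z2 - z1 * x2))
    (pow2_ge_0 (y1 * z2 - z1 * y2)). lra. }
assert (H1 := sqrt_pos A). assert (H2 := sqrt_pos B).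
rewrite <- (sqrt_pow2 (sqrt A + sqrt B)) by lra.
apply sqrt_le_1_alt.
replace ((sqrt A + sqrt B) ^ 2) with (sqrt A ^ 2 + sqrt B ^ 2 + 2 * (sqrt A * sqrt B)) by ring.
rewrite !pow2_sqrt by easy. unfold A, B in *. nra.
Qed.

(** For [y = t / 2 >= 0] the bound [sin y >= y - y^3 / 6] gives [sin (t / 2) >= t / 6] as long as
    [t^2 <= 16], which [PI <= 4] ensures. The constant is not sharp. *)
Lemma sin_half_lower (t : R) : Rabs t <= PI -> t ^ 2 / 36 <= sin (t / 2) ^ 2.
Proof.
assert (H : forall t, 0 <= t <= PI -> t ^ 2 / 36 <= sin (t / 2) ^ 2).
{ clear t. intros t Ht. assert (H4 := PI_4).
  destruct (pre_sin_bound (t / 2) 0) as [Hb _]; [lra|lra|].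
  unfold sin_approx, sin_term in Hb. simpl in Hb.
  assert (t / 6 <= sin (t / 2)); [|nra].
  eapply Rle_trans; [|exact Hb].
  apply Rminus_le_0. field_simplify.
  assert (0 <= t * (16 - t ^ 2)) by (apply Rmult_le_pos; nra). nra. }
intros Ht. destruct (Rle_dec 0 t) as [H0|H0].
- apply H. rewrite Rabs_pos_eq in Ht; lra.
- rewrite Rabs_left in Ht by lra.
  replace (t ^ 2) with ((- t) ^ 2) by ring.
  replace (sin (t / 2) ^ 2) with (sin (- t / 2) ^ 2);
    [apply H; lra|].
  replace (- t / 2) with (- (t / 2)) by field. rewrite sin_neg. ring.
Qed.

(** Expanding the squares and using [4 sin^2 (t/2) = 2 - 2 cos t] turns the squared chord into two
    nonnegative terms, one for each increment, that can be bounded below separately. *)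
Lemma dE_Phi (Rt r th ph t s : R) :
  dE (Phi Rt r th ph) (Phi Rt r (th + t) (ph + s)) =
  sqrt (4 * r ^ 2 * sin (t / 2) ^ 2
        + 4 * (Rt + r * cos th) * (Rt + r * cos (th + t)) * sin (s / 2) ^ 2).
Proof.
assert (Hhalf : forall t, 4 * sin (t / 2) ^ 2 = 2 - 2 * cos t).
{ intros y. replace y with (2 * (y / 2)) at 2 by field.
  rewrite cos_2a_sin. ring. }
unfold dE, Phi, cx, cy, cz; simpl fst; simpl snd. f_equal.
set (g := Rt + r * cos th). set (g' := Rt + r * cos (th + t)).
replace (4 * r ^ 2 * sin (t / 2) ^ 2 + 4 * g * g' * sin (s / 2) ^ 2)
  with (r ^ 2 * (4 * sin (t / 2) ^ 2) + g * g' * (4 * sin (s / 2) ^ 2)) by ring.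
rewrite !Hhalf.
replace (cos s) with (cos (ph + s - ph)) by (f_equal; ring).
replace (cos t) with (cos (th + t - th)) by (f_equal; ring).
rewrite !cos_minus.
assert (E : forall x, sin x ^ 2 = 1 - cos x ^ 2)
  by (intros x; generalize (sin2_cos2 x); unfold Rsqr; lra).
ring_simplify. rewrite !E. unfold g, g'. ring.
Qed.

Lemma increments_le_dE (Rt r : R) : 0 < r -> r < Rt ->
  exists K, 0 < K /\ forall th ph t s, Rabs t <= PI -> Rabs s <= PI ->
    Rabs t + Rabs s <= K * dE (Phi Rt r th ph) (Phi Rt r (th + t) (ph + s)).
Proof.
(* The two terms of [dE_Phi] show that the distance is at least [r |t| / 3] and at least
   [(Rt - r) |s| / 3]. *)
intros hr hRr. exists (3 / r + 3 / (Rt - r)).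
assert (H1 : 0 < 3 / r) by (apply Rdiv_lt_0_compat; lra).
assert (H2 : 0 < 3 / (Rt - r)) by (apply Rdiv_lt_0_compat; lra).
split; [lra|]. intros th ph t s Ht Hs. rewrite dE_Phi.
apply sin_half_lower in Ht. apply sin_half_lower in Hs.
assert (Hg : forall x, Rt - r <= Rt + r * cos x)
  by (intros x; destruct (COS_bound x); nra).
assert (G1 := Hg th). assert (G2 := Hg (th + t)).
set (g := Rt + r * cos th) in *. set (g' := Rt + r * cos (th + t)) in *.
assert (HG : (Rt - r) ^ 2 <= g * g').
{ replace ((Rt - r) ^ 2) with ((Rt - r) * (Rt - r)) by ring.
  apply Rmult_le_compat; lra. }
assert (Q1 : 0 <= sin (t / 2) ^ 2) by nra.
assert (Q2 : 0 <= sin (s / 2) ^ 2) by nra.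
set (A := 4 * r ^ 2 * _ + _).
assert (A1 : (r * Rabs t / 3) ^ 2 <= A).
{ replace ((r * Rabs t / 3) ^ 2) with (4 * r ^ 2 * (Rabs t ^ 2 / 36)) by field.
  rewrite pow2_abs. unfold A.
  assert (4 * r ^ 2 * (t ^ 2 / 36) <= 4 * r ^ 2 * sin (t / 2) ^ 2)
    by (apply Rmult_le_compat_l; nra).
  assert (0 <= 4 * (g * g') * sin (s / 2) ^ 2) by (apply Rmult_le_pos; nra). nra. }
assert (A2 : ((Rt - r) * Rabs s / 3) ^ 2 <= A).
{ replace (((Rt - r) * Rabs s / 3) ^ 2)
    with (4 * (Rt - r) ^ 2 * (Rabs s ^ 2 / 36)) by field.
  rewrite pow2_abs. unfold A.
  assert (4 * (Rt - r) ^ 2 * (s ^ 2 / 36) <= 4 * (g * g') * sin (s / 2) ^ 2)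
    by (apply Rmult_le_compat; nra).
  assert (0 <= 4 * r ^ 2 * sin (t / 2) ^ 2) by (apply Rmult_le_pos; nra). nra. }
apply sqrt_le_1_alt in A1. apply sqrt_le_1_alt in A2.
assert (Ht' := Rabs_pos t). assert (Hs' := Rabs_pos s).
rewrite sqrt_pow2 in A1 by nra. rewrite sqrt_pow2 in A2 by nra.
rewrite Rmult_plus_distr_r. apply Rplus_le_compat.
- apply Rmult_le_reg_l with (r / 3); [lra|].
  replace (r / 3 * (3 / r * sqrt A)) with (sqrt A) by (field; lra). lra.
- apply Rmult_le_reg_l with ((Rt - r) / 3); [lra|].
  replace ((Rt - r) / 3 * (3 / (Rt - r) * sqrt A)) with (sqrt A) by (field; lra).
  lra.
Qed.

(** * Periodicity and the norm of the lift *)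

Lemma periodic_reduce (x : R) :
  exists k : Z, 0 <= x - IZR k * (2 * PI) <= 2 * PI.
Proof.
assert (HPI := PI_RGT_0).
exists (Int_part (x / (2 * PI))).
destruct (base_Int_part (x / (2 * PI))) as [H1 H2].
set (k := IZR (Int_part _)) in *.
replace (x - k * (2 * PI)) with ((x / (2 * PI) - k) * (2 * PI))
  by (field; lra).
set (q := x / (2 * PI)) in *. split; nra.
Qed.

Lemma periodic_Z (g : R -> R) : (forall x, g (x + 2 * PI) = g x) ->
  forall (k : Z) x, g (x - IZR k * (2 * PI)) = g x.
Proof.
intros Hg k.
assert (Hn : forall (n : nat) x, g (x + INR n * (2 * PI)) = g x).
{ induction n as [|n IH]; intros x.
  - simpl. f_equal. ring.
  - rewrite S_INR.
    replace (x + (INR n + 1) * (2 * PI))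
      with (x + INR n * (2 * PI) + 2 * PI) by ring.
    now rewrite Hg. }
intros x. destruct (Z.le_ge_cases 0 k) as [Hk|Hk].
- rewrite <- (Z2Nat.id k), <- INR_IZR_INZ, <- (Hn (Z.to_nat k)) by easy.
  f_equal. ring.
- rewrite <- (Hn (Z.to_nat (- k)) x).
  rewrite INR_IZR_INZ, Z2Nat.id, opp_IZR by lia. f_equal. ring.
Qed.

Lemma partial_derive_lift_periodic (Rt r : R) (f : point -> R) (a b : nat)
    (x y : R) :
  partial_derive a b (lift Rt r f) (x + 2 * PI) y
    = partial_derive a b (lift Rt r f) x y /\
  partial_derive a b (lift Rt r f) x (y + 2 * PI)
    = partial_derive a b (lift Rt r f) x y.
Proof.
assert (Hp : forall x, cos (x + 2 * PI) = cos x /\ sin (x + 2 * PI) = sin x).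
{ intros z. rewrite cos_plus, sin_plus, cos_2PI, sin_2PI. split; ring. }
unfold partial_derive. split.
- rewrite <- (Derive_n_comp_trans
    (fun t => Derive_n (fun z => lift Rt r f t z) b y)).
  apply Derive_n_ext. intros t. apply Derive_n_ext. intros z.
  unfold lift, Phi. now destruct (Hp t) as [-> ->].
- apply Derive_n_ext. intros t.
  rewrite <- (Derive_n_comp_trans (fun z => lift Rt r f t z)).
  apply Derive_n_ext. intros z.
  unfold lift, Phi. now destruct (Hp z) as [-> ->].
Qed.

Lemma Rbar_le_max_l (a b : Rbar) : Rbar_le a (Rbar_max a b).
Proof.
unfold Rbar_max. destruct (Rbar_le_dec a b); [easy|apply Rbar_le_refl].
Qed.

Lemma Rbar_le_max_r (a b : Rbar) : Rbar_le b (Rbar_max a b).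
Proof.
unfold Rbar_max. destruct (Rbar_le_dec a b) as [H|H]; [apply Rbar_le_refl|].
apply Rbar_lt_le, Rbar_not_le_lt, H.
Qed.

Lemma Rbar_le_maxl (l : list Rbar) (a : Rbar) :
  In a l -> Rbar_le a (Rbar_maxl l).
Proof.
induction l as [|b l IH]; [easy|]. intros [->|H]; simpl.
- apply Rbar_le_max_l.
- eapply Rbar_le_trans; [now apply IH|apply Rbar_le_max_r].
Qed.

Lemma Rbar_maxl_pos (l : list Rbar) : Rbar_le 0 (Rbar_maxl l).
Proof.
induction l as [|b l IH]; [apply Rle_refl|].
eapply Rbar_le_trans; [exact IH|apply Rbar_le_max_r].
Qed.

(** The norm only sees the square [[0, 2 PI]^2], whereas Taylor's formula is used around arbitrary
    angles; periodicity of the derivatives of the lift carries the bound to the whole plane. *)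
Lemma Ck_norm_bound (Rt r : R) (k : nat) (f : point -> R) (M : R) :
  Ck_norm Rt r k f = Finite M ->
  forall a b x y, (a + b <= k)%nat ->
    Rabs (partial_derive a b (lift Rt r f) x y) <= M.
Proof.
intros HM a b.
set (g := partial_derive a b (lift Rt r f)).
intros x y Hab.
destruct (periodic_reduce x) as [kx Hx]. destruct (periodic_reduce y) as [ky Hy].
assert (Hg : g x y = g (x - IZR kx * (2 * PI)) (y - IZR ky * (2 * PI))).
{ rewrite (periodic_Z (fun y => g (x - IZR kx * (2 * PI)) y)).
  - rewrite (periodic_Z (fun x => g x y)); [easy|].
    intros z. apply partial_derive_lift_periodic.
  - intros z. apply partial_derive_lift_periodic. }
rewrite Hg.
change (Rbar_le (Rabs (g (x - IZR kx * (2 * PI)) (y - IZR ky * (2 * PI)))) (Finite M)).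
rewrite <- HM. unfold Ck_norm.
eapply Rbar_le_trans; [|apply Rbar_le_maxl, (in_map (fun a => sup_norm
  (fun tp : R * R => 0 <= fst tp <= 2 * PI /\ 0 <= snd tp <= 2 * PI)
  (fun tp => partial_derive (fst a) (snd a) (lift Rt r f) (fst tp) (snd tp)))
  (multi_indices k) (a, b))].
- apply (proj1 (Lub_Rbar_correct _)).
  exists (x - IZR kx * (2 * PI), y - IZR ky * (2 * PI)). simpl. auto.
- unfold multi_indices. apply filter_In. split.
  + apply in_prod; apply in_seq; lia.
  + apply Nat.leb_le. simpl. lia.
Qed.

Lemma local_polynomial_approx (Rt r : R) (d : nat) : 0 < r -> r < Rt ->
  exists K, 0 < K /\ forall f M,
    Ck_torus Rt r (S d) f -> Ck_norm Rt r (S d) f = Finite M ->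
    forall x, torus Rt r x -> exists P, poly_le d P /\
      forall y, torus Rt r y -> Rabs (f y - P y) <= K * M * dE x y ^ S d.
Proof.
intros hr hRr.
destruct (smooth_approx Rt r d hr hRr) as [K [HK0 HK]].
destruct (increments_le_dE Rt r hr hRr) as [K' [HK'0 HK']].
assert (HKd : 0 < K' ^ S d) by now apply pow_lt.
(* [K + 1] instead of [K] makes the constant strictly positive; [K'] converts increments of angles
   into distances. *)
exists ((K + 1) * K' ^ S d). split; [apply Rmult_lt_0_compat; lra|].
intros f M Hf HM x Hx.
assert (Hb := Ck_norm_bound Rt r (S d) f M HM).
assert (HM0 : 0 <= M).
{ eapply Rle_trans; [apply Rabs_pos|apply (Hb 0%nat 0%nat 0 0); lia]. }
destruct (torus_angles Rt r x hr hRr Hx) as [th [ph ->]].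
destruct (HK (lift Rt r f) M Hf Hb th ph) as [P [HP HPf]].
exists P. split; [easy|]. intros y Hy.
destruct (torus_angles Rt r y hr hRr Hy) as [th' [ph' ->]].
destruct (angle_increment th' th) as [t [Ht [Hct Hst]]].
destruct (angle_increment ph' ph) as [s [Hs [Hcs Hss]]].
replace (Phi Rt r th' ph') with (Phi Rt r (th + t) (ph + s))
  by (unfold Phi; now rewrite Hct, Hst, Hcs, Hss).
assert (H4 := PI_4).
specialize (HPf t s (Rle_trans _ _ _ Ht H4) (Rle_trans _ _ _ Hs H4)).
specialize (HK' th ph t s Ht Hs).
set (D := dE _ _) in *. assert (HD : 0 <= D) by apply dE_pos.
eapply Rle_trans; [exact HPf|].
assert (Ht' := Rabs_pos t). assert (Hs' := Rabs_pos s).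
assert (HE : (Rabs t + Rabs s) ^ S d <= K' ^ S d * D ^ S d).
{ rewrite <- Rpow_mult_distr. apply pow_incr. lra. }
assert (0 <= K' ^ S d * D ^ S d) by (apply Rmult_le_pos; apply pow_le; lra).
replace ((K + 1) * K' ^ S d * M * D ^ S d)
  with ((K + 1) * M * (K' ^ S d * D ^ S d)) by ring.
apply Rmult_le_compat; [nra|apply pow_le; lra|nra|easy].
Qed.

(** * Interpolation and weights *)

Lemma Rsum_map_le {A : Type} (u v : A -> R) (l : list A) :
  (forall a, In a l -> u a <= v a) -> Rsum (map u l) <= Rsum (map v l).
Proof.
induction l as [|a l IH]; simpl; intros H; [lra|].
apply Rplus_le_compat; auto.
Qed.

Lemma Rsum_map_scal {A : Type} (c : R) (u : A -> R) (l : list A) :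
  Rsum (map (fun a => c * u a) l) = c * Rsum (map u l).
Proof. induction l as [|a l IH]; simpl; [ring|]. rewrite IH. ring. Qed.

Lemma Rsum_map_minus {A : Type} (u v : A -> R) (l : list A) :
  Rsum (map (fun a => u a - v a) l) = Rsum (map u l) - Rsum (map v l).
Proof. induction l as [|a l IH]; simpl; [ring|]. rewrite IH. ring. Qed.

Lemma Rabs_Rsum_map_le {A : Type} (u : A -> R) (l : list A) :
  Rabs (Rsum (map u l)) <= Rsum (map (fun a => Rabs (u a)) l).
Proof.
induction l as [|a l IH]; simpl; [rewrite Rabs_R0; lra|].
eapply Rle_trans; [apply Rabs_triang|]. lra.
Qed.

Lemma Rsum_map_delta {A : Type} (u : A -> R) (l : list A) (a : A) :
  NoDup l -> In a l -> (forall b, In b l -> b <> a -> u b = 0) ->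
  Rsum (map u l) = u a.
Proof.
assert (H0 : forall l, (forall b, In b l -> u b = 0) -> Rsum (map u l) = 0).
{ clear l. induction l as [|b l IH]; simpl; intros H; [easy|].
  rewrite H, IH by auto. ring. }
induction 1 as [|b l Hb Hl IH]; simpl; [easy|]. intros [->|Ha] H.
- rewrite H0; [ring|]. intros b Hb'. apply H; [auto|]. now intros ->.
- rewrite IH by auto. rewrite H; [ring|auto|]. now intros ->.
Qed.

Lemma Rsum_map_pos {A : Type} (u : A -> R) (l : list A) (a : A) :
  (forall b, In b l -> 0 <= u b) -> In a l -> 0 < u a ->
  0 < Rsum (map u l).
Proof.
assert (H0 : forall l, (forall b, In b l -> 0 <= u b) -> 0 <= Rsum (map u l)).
{ clear l. induction l as [|b l IH]; simpl; intros H; [lra|].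
  apply Rplus_le_le_0_compat; auto. }
induction l as [|b l IH]; simpl; [easy|]. intros H [->|Ha] Hpos.
- apply Rplus_lt_le_0_compat; auto.
- apply Rplus_le_lt_0_compat; auto.
Qed.

Lemma Rmaxl_ge (l : list R) (a : R) : In a l -> a <= Rmaxl l.
Proof.
induction l as [|b l IH]; [easy|]. intros [->|H]; simpl; [apply Rmax_l|].
eapply Rle_trans; [now apply IH|apply Rmax_r].
Qed.

Lemma dE_le_diam (s : list point) (p q : point) :
  In p s -> In q s -> dE p q <= diam s.
Proof.
intros Hp Hq. apply Rmaxl_ge.
apply (in_map (fun pq => dE (fst pq) (snd pq)) _ (p, q)). now apply in_prod.
Qed.

Lemma Hd_add (T : point -> Prop) (d : nat) (p q : point -> R) :
  Hd T d p -> Hd T d q -> Hd T d (fun x => p x + q x).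
Proof.
intros [c Hc] [c' Hc']. exists (fun i j k => c i j k + c' i j k).
intros x Hx. now rewrite poly3_add, Hc, Hc'.
Qed.

Lemma Hd_scal (T : point -> Prop) (d : nat) (a : R) (p : point -> R) :
  Hd T d p -> Hd T d (fun x => a * p x).
Proof.
intros [c Hc]. exists (fun i j k => a * c i j k).
intros x Hx. now rewrite poly3_scal, Hc.
Qed.

Lemma Hd_Rsum {A : Type} (T : point -> Prop) (d : nat) (u : A -> point -> R)
    (l : list A) :
  (forall a, In a l -> Hd T d (u a)) ->
  Hd T d (fun x => Rsum (map (fun a => u a x) l)).
Proof.
induction l as [|a l IH]; intros H.
- apply poly_le_Hd, (poly_le_const d 0).
- apply (Hd_add T d (u a)); [|apply IH]; intros; apply H; simpl; auto.
Qed.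

Lemma interpolant_spec (T : point -> Prop) (d : nat) (s : list point)
    (f : point -> R) : unisolvent T d s ->
  Hd T d (interpolant T d s f) /\
  forall x, In x s -> interpolant T d s f x = f x.
Proof.
intros [_ [_ [_ Huni]]]. destruct (Huni f) as [p [Hp _]].
apply (epsilon_spec (inhabits (fun _ : point => 0))
  (fun p => Hd T d p /\ forall x, In x s -> p x = f x)).
now exists p.
Qed.

Lemma fundamental_spec (T : point -> Prop) (d : nat) (s : list point)
    (xi : point) : unisolvent T d s -> In xi s ->
  let p := fundamental T d s xi in
  Hd T d p /\ p xi = 1 /\ forall eta, In eta s -> eta <> xi -> p eta = 0.
Proof.
intros [_ [_ [_ Huni]]] Hxi.
apply (epsilon_spec (inhabits (fun _ : point => 0))
  (fun p => Hd T d p /\ p xi = 1 /\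
     forall eta, In eta s -> eta <> xi -> p eta = 0)).
destruct (Huni (fun x => if excluded_middle_informative (x = xi) then 1 else 0))
  as [p [[Hp Hv] _]].
exists p. split; [easy|]. split.
- rewrite Hv by easy. now destruct (excluded_middle_informative _).
- intros eta Heta Hne. rewrite Hv by easy.
  now destruct (excluded_middle_informative _).
Qed.

(** Lagrange's formula applied to [f - P]: the function [q] adds to [P] the fundamental polynomials
    weighted by the nodal values of [f - P]. It lies in [Hd] and interpolates [f], hence equals the
    interpolant on [T] by uniqueness. *)
Lemma interpolant_error (T : point -> Prop) (d : nat) (s : list point)
    (f P : point -> R) (E : R) (x : point) :
  unisolvent T d s -> Hd T d P -> T x ->
  (forall xi, In xi s -> Rabs (f xi - P xi) <= E) ->
  Rabs (interpolant T d s f x - P x)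
  <= E * Rsum (map (fun xi => Rabs (fundamental T d s xi x)) s).
Proof.
intros Hs HP Hx HE.
pose (q := fun y => P y
  + Rsum (map (fun xi => (f xi - P xi) * fundamental T d s xi y) s)).
assert (Hq : interpolant T d s f x = q x).
{ destruct (interpolant_spec T d s f Hs) as [H1 H2].
  assert (Hs' := Hs). destruct Hs' as [Hnd [_ [_ Huni]]].
  destruct (Huni f) as [p [_ Hun]].
  rewrite (Hun _ H1 H2 x Hx). symmetry. apply Hun; [| |easy].
  - apply Hd_add; [easy|].
    apply (Hd_Rsum T d (fun xi y => (f xi - P xi) * fundamental T d s xi y)).
    intros xi Hxi. apply Hd_scal. now apply fundamental_spec.
  - intros eta Heta. unfold q. rewrite (Rsum_map_delta _ s eta); [|easy|easy|].
    + destruct (fundamental_spec T d s eta Hs Heta) as [_ [H _]].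
      rewrite H. ring.
    + intros xi Hxi Hne. destruct (fundamental_spec T d s xi Hs Hxi) as [_ [_ H]].
      rewrite H by auto. ring. }
rewrite Hq. unfold q.
match goal with |- Rabs (?a + ?b - ?a') <= _ =>
  replace (a + b - a') with b by ring end.
eapply Rle_trans; [apply Rabs_Rsum_map_le|].
rewrite <- Rsum_map_scal. apply Rsum_map_le. intros xi Hxi.
rewrite Rabs_mult. apply Rmult_le_compat_r; [apply Rabs_pos|auto].
Qed.

Lemma weighted_mean_error {A : Type} (w v : A -> R) (l : list A) (c E : R) :
  (forall a, In a l -> 0 <= w a) -> Rsum (map w l) = 1 ->
  (forall a, In a l -> Rabs (c - v a) <= E) ->
  Rabs (c - Rsum (map (fun a => w a * v a) l)) <= E.
Proof.
intros Hw Hw1 Hv.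
replace (c - Rsum (map (fun a => w a * v a) l))
  with (Rsum (map (fun a => w a * (c - v a)) l)).
- eapply Rle_trans; [apply Rabs_Rsum_map_le|].
  replace E with (E * Rsum (map w l)) by (rewrite Hw1; ring).
  rewrite <- Rsum_map_scal. apply Rsum_map_le. intros a Ha.
  rewrite Rabs_mult, Rabs_pos_eq, Rmult_comm by auto.
  apply Rmult_le_compat_r; auto.
- transitivity (c * Rsum (map w l) - Rsum (map (fun a => w a * v a) l));
    [|rewrite Hw1; ring].
  rewrite <- Rsum_map_scal, <- Rsum_map_minus. f_equal.
  apply map_ext. intros a. ring.
Qed.

(** * Weights and active stencils *)

Lemma pos_power_nonneg (t mu : R) : 0 <= pos_power t mu.
Proof.
unfold pos_power. destruct (Rlt_dec 0 t); [|lra].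
left. apply exp_pos.
Qed.

Lemma omega_nonneg (s : list point) (rho mu : R) (x : point) :
  0 <= omega s rho mu x.
Proof.
unfold omega. induction s as [|xi s IH]; simpl; [lra|].
apply Rmult_le_pos; [apply pos_power_nonneg|easy].
Qed.

Lemma omega_pos (s : list point) (rho mu : R) (x : point) :
  ~ In x s -> (forall xi, In xi s -> dE x xi < rho) -> 0 < omega s rho mu x.
Proof.
unfold omega. induction s as [|xi s IH]; simpl; intros Hx H; [lra|].
apply Rmult_lt_0_compat; [|apply IH; auto].
assert (Hxi : 0 < dE x xi).
{ destruct (dE_pos x xi) as [Hp|Hz]; [easy|].
  destruct Hx. left. symmetry. now apply dE_eq0. }
assert (dE x xi < rho) by auto.
unfold pos_power. destruct (Rlt_dec 0 (/ dE x xi - / rho)) as [_|Hn].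
- apply exp_pos.
- destruct Hn. apply Rlt_0_minus, Rinv_lt_contravar; [|easy].
  apply Rmult_lt_0_compat; lra.
Qed.

Lemma in_active (T : point -> Prop) (L : nat) (sigma : nat -> list point)
    (rho : nat -> R) (x : point) (j : nat) :
  In j (active T L sigma rho x) <->
  (j < L)%nat /\ interior_in T (support_set T (sigma j) (rho j)) x.
Proof.
unfold active. rewrite filter_In, in_seq.
destruct (excluded_middle_informative _) as [H|H];
  split; intros [H1 H2]; try easy; split; try easy; lia.
Qed.

Lemma interior_support_dE (T : point -> Prop) (s : list point) (rho : R)
    (x xi : point) :
  interior_in T (support_set T s rho) x -> In xi s -> dE x xi <= rho.
Proof.
intros [HT [eps [Heps H]]] Hxi.
destruct (H x HT) as [_ H']; [now rewrite dE_refl|]. auto.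
Qed.

Lemma interior_support_intro (T : point -> Prop) (s : list point)
    (rho eps : R) (x : point) : T x -> 0 < eps ->
  (forall xi, In xi s -> dE x xi + eps <= rho) ->
  interior_in T (support_set T s rho) x.
Proof.
intros HT Heps H. split; [easy|]. exists eps. split; [easy|].
intros y Hy Hxy. split; [easy|]. intros xi Hxi.
generalize (dE_triangle y x xi) (H xi Hxi). rewrite (dE_sym y x). lra.
Qed.

Lemma weights_sum (T : point -> Prop) (L : nat) (sigma : nat -> list point)
    (rho : nat -> R) (mu : R) (x : point) (j0 : nat) :
  In j0 (active T L sigma rho x) -> 0 < omega (sigma j0) (rho j0) mu x ->
  (forall j, In j (active T L sigma rho x) ->
     0 <= weight T L sigma rho mu j x) /\
  Rsum (map (fun j => weight T L sigma rho mu j x) (active T L sigma rho x)) = 1.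
Proof.
intros Hj0 Hom.
set (J := active T L sigma rho x) in *.
set (om := fun k => omega (sigma k) (rho k) mu x).
assert (HS : 0 < Rsum (map om J)).
{ apply Rsum_map_pos with j0; [|easy|easy]. intros. apply omega_nonneg. }
assert (Hw : forall j, In j J ->
  weight T L sigma rho mu j x = / Rsum (map om J) * om j).
{ intros j Hj. unfold weight. fold J.
  destruct (in_dec Nat.eq_dec j J); [|easy]. apply Rmult_comm. }
split.
- intros j Hj. rewrite Hw by easy. apply Rmult_le_pos; [|apply omega_nonneg].
  left. now apply Rinv_0_lt_compat.
- rewrite (map_ext_in _ (fun j => / Rsum (map om J) * om j)) by easy.
  rewrite Rsum_map_scal. apply Rinv_l. lra.
Qed.

Lemma list_argmin {A : Type} (u : A -> R) (l : list A) : l <> nil ->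
  exists a, In a l /\ forall b, In b l -> u a <= u b.
Proof.
induction l as [|a l IH]; [easy|]. intros _.
destruct l as [|b l].
- exists a. split; [now left|]. intros c [->|[]]. lra.
- destruct IH as [m [Hm Hmin]]; [easy|].
  destruct (Rle_dec (u a) (u m)) as [H|H].
  + exists a. split; [now left|]. intros c [->|Hc]; [lra|].
    apply Rle_trans with (u m); auto.
  + exists m. split; [now right|]. intros c [->|Hc]; [lra|auto].
Qed.

Lemma fill_distance_node (T : point -> Prop) (X : list point) (h : R)
    (x : point) :
  fill_distance T X = Finite h -> T x -> exists xi, In xi X /\ dE x xi <= h.
Proof.
unfold fill_distance. intros Hh Hx.
match type of Hh with Lub_Rbar ?Q = _ =>
  generalize (Lub_Rbar_correct Q); rewrite Hh; intros [Hub Hlub] end.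
destruct X as [|xi0 X].
(* With no nodes the set of distances is empty, so every real is an upper bound and its least upper
   bound cannot be the finite [h]. *)
- assert (H : Rbar_le (Finite h) (Finite (h - 1))).
  { apply Hlub. now intros t [y [_ [[xi [[] _]] _]]]. }
  simpl in H. lra.
- destruct (list_argmin (dE x) (xi0 :: X)) as [xi [Hxi Hmin]]; [easy|].
  exists xi. split; [easy|]. apply (Hub (dE x xi)).
  exists x. split; [easy|]. split; [now exists xi|easy].
Qed.

Lemma stability_factor_bound (T : point -> Prop) (d L : nat)
    (sigma : nat -> list point) (rho : nat -> R) (Lam : R) (x : point)
    (j : nat) :
  Rbar_le (stability_factor T d L sigma rho) (Finite Lam) -> T x ->
  In j (active T L sigma rho x) ->
  Rsum (map (fun xi => Rabs (fundamental T d (sigma j) xi x)) (sigma j)) <= Lam.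
Proof.
intros HLam Hx Hj.
eapply Rle_trans; [apply Rmaxl_ge|].
- apply (in_map (fun j => Rsum (map (fun xi =>
    Rabs (fundamental T d (sigma j) xi x)) (sigma j))) _ j Hj).
- apply (Rbar_le_trans (Finite _) (stability_factor T d L sigma rho) (Finite Lam));
    [|exact HLam].
  apply (proj1 (Lub_Rbar_correct _)). now exists x.
Qed.

(** * The error estimate *)

Theorem corollary1 (Rt r : R) (hr : 0 < r) (hRr : r < Rt) (d : nat)
  (Hs : R -> Prop)
  (Hs_to_0 : forall eps, 0 < eps -> exists h, Hs h /\ h < eps)
  (X : R -> list point)
  (X_nodup : forall h, Hs h -> NoDup (X h))
  (X_torus : forall h x, Hs h -> In x (X h) -> torus Rt r x)
  (X_fill : forall h, Hs h -> fill_distance (torus Rt r) (X h) = Finite h)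
  (L : R -> nat) (sigma : R -> nat -> list point)
  (sigma_unisolvent : forall h j, Hs h -> (j < L h)%nat ->
     unisolvent (torus Rt r) d (sigma h j))
  (sigma_cover : forall h x, Hs h ->
     (In x (X h) <-> exists j, (j < L h)%nat /\ In x (sigma h j)))
  (CH Csigma Lam : R) (hCH : 0 < CH) (hCsigma : 0 < Csigma) (hLam : 0 < Lam)
  (H : R -> R)
  (H_bounds : forall h, Hs h -> h < H h /\ H h <= CH * h)
  (diam_bound : forall h, Hs h ->
     Rmaxl (map (fun j => diam (sigma h j)) (seq 0 (L h))) <= Csigma * h)
  (rho : R -> nat -> R)
  (rho_def : forall h j, Hs h -> (j < L h)%nat ->
     rho h j = diam (sigma h j) + H h)
  (stability_bound : forall h, Hs h ->
     Rbar_le (stability_factor (torus Rt r) d (L h) (sigma h) (rho h))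
             (Finite Lam)) :
  exists C h0 : R, 0 < h0 /\
    forall h mu f, Hs h -> h < h0 -> 0 < mu ->
      Ck_torus Rt r (S d) f ->
      Rbar_le
        (sup_norm (torus Rt r)
           (fun x => f x - multinode_shepard (torus Rt r) d (X h) (L h)
                             (sigma h) (rho h) mu f x))
        (Rbar_mult (Finite (C * h ^ (S d))) (Ck_norm Rt r (S d) f)).
Proof.
destruct (local_polynomial_approx Rt r d hr hRr) as [K [HK0 HK]].
(* [K] measures the local polynomial approximation, [(Csigma + CH) * h] bounds the distance from [x]
   to the nodes of an active stencil, and [Lam] bounds the sum of its fundamental polynomials in
   absolute value. *)
pose (Q := K * (Csigma + CH) ^ S d * Lam).
assert (HQ : 0 < Q).
{ apply Rmult_lt_0_compat; [|easy]. apply Rmult_lt_0_compat; [easy|].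
  apply pow_lt. lra. }
exists Q, 1. split; [lra|]. intros h mu f Hh _ Hmu Hf.
apply (proj2 (Lub_Rbar_correct _)). intros e [x [Hx ->]].
destruct (fill_distance_node _ _ _ _ (X_fill h Hh) Hx) as [xi0 [Hxi0 Hdxi0]].
(* A distance is at most [h], so [0 <= h]; and [h = 0] would give [0 < H 0 <= CH * 0]. *)
assert (Hh0 : 0 < h).
{ destruct (H_bounds h Hh) as [H1 H2]. assert (H3 := dE_pos x xi0).
  destruct (Rle_lt_or_eq_dec 0 h) as [H4|H4]; [lra|easy|].
  rewrite <- H4 in *. lra. }
assert (Hhd : 0 < h ^ S d) by now apply pow_lt.
assert (HQh : 0 < Q * h ^ S d) by now apply Rmult_lt_0_compat.
assert (HM0 := Rbar_maxl_pos (map (fun a => sup_norm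
  (fun tp : R * R => 0 <= fst tp <= 2 * PI /\ 0 <= snd tp <= 2 * PI)
  (fun tp => partial_derive (fst a) (snd a) (lift Rt r f) (fst tp) (snd tp)))
  (multi_indices (S d)))).
fold (Ck_norm Rt r (S d) f) in HM0.
(* If the norm is [+oo], so is the right-hand side, because its factor [Q * h ^ S d] is positive;
   [HM0] excludes [-oo]. *)
destruct (Ck_norm Rt r (S d) f) as [M| |] eqn:HM; [|
  unfold Rbar_mult, Rbar_mult';
  destruct (Rle_dec 0 (Q * h ^ S d)) as [Hle|Hle]; [|lra];
  destruct (Rle_lt_or_eq_dec _ _ Hle); [easy|lra] | easy].
simpl in HM0.
match goal with |- Rbar_le (Finite ?e) _ => change (e <= Q * h ^ S d * M) end.
assert (Hbound : 0 <= Q * h ^ S d * M) by (apply Rmult_le_pos; lra).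
unfold multinode_shepard.
destruct (excluded_middle_informative (In x (X h))) as [HxX|HxX].
{ rewrite Rminus_diag, Rabs_R0. exact Hbound. }
destruct (HK f M Hf HM x Hx) as [P [HP HPf]].
(* The error bound of [P] vanishes at the base point since [dE x x = 0] and the exponent [S d] is
   positive. *)
assert (HfP : f x = P x).
{ specialize (HPf x Hx). rewrite dE_refl, pow_i, Rmult_0_r in HPf by lia.
  assert (HR := Rabs_pos (f x - P x)).
  apply Rminus_diag_uniq. destruct (Req_dec (f x - P x) 0) as [E|E]; [easy|].
  apply Rabs_pos_lt in E. lra. }
destruct (proj1 (sigma_cover h xi0 Hh) Hxi0) as [j0 [Hj0 Hxij0]].
destruct (H_bounds h Hh) as [HH1 HH2].
(* Every node of this stencil is within [h + diam] of [x], while the radius is [diam + H h]. The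
   margin [H h - h > 0] serves as the radius of a neighbourhood of [x] inside the support set. *)
assert (Hclose : forall eta, In eta (sigma h j0) ->
  dE x eta + (H h - h) <= rho h j0).
{ intros eta Heta. rewrite rho_def by easy.
  generalize (dE_triangle x xi0 eta) (dE_le_diam _ _ _ Hxij0 Heta). lra. }
destruct (weights_sum (torus Rt r) (L h) (sigma h) (rho h) mu x j0)
  as [Hw0 Hw1].
{ apply in_active. split; [easy|].
  apply interior_support_intro with (H h - h); [easy|lra|easy]. }
{ apply omega_pos.
  - intros Hin. apply HxX. apply sigma_cover; [easy|]. now exists j0.
  - intros eta Heta. specialize (Hclose eta Heta). lra. }
apply weighted_mean_error; [easy|easy|]. intros j Hj.
assert (Hj' := Hj). apply in_active in Hj'. destruct Hj' as [HjL Hint].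
rewrite HfP, Rabs_minus_sym.
assert (Hdiam : diam (sigma h j) <= Csigma * h).
{ eapply Rle_trans; [|apply (diam_bound h Hh)]. apply Rmaxl_ge.
  apply (in_map (fun j => diam (sigma h j))). apply in_seq. lia. }
eapply Rle_trans.
- apply (interpolant_error _ d (sigma h j) f P
    (K * M * ((Csigma + CH) * h) ^ S d) x (sigma_unisolvent h j Hh HjL)
    (poly_le_Hd _ d P HP) Hx).
  intros xi Hxi.
  assert (Hxit : torus Rt r xi).
  { apply (X_torus h); [easy|]. apply sigma_cover; [easy|]. now exists j. }
  eapply Rle_trans; [now apply HPf|].
  apply Rmult_le_compat_l; [nra|]. apply pow_incr. split; [apply dE_pos|].
  (* Being active gives [dE x xi <= diam + H h], which is at most [(Csigma + CH) * h]. *)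
  generalize (interior_support_dE _ _ _ _ _ Hint Hxi).
  rewrite rho_def by easy. lra.
- replace (Q * h ^ S d * M) with (K * M * ((Csigma + CH) * h) ^ S d * Lam)
    by (unfold Q; rewrite Rpow_mult_distr; ring).
  apply Rmult_le_compat_l.
  + apply Rmult_le_pos; [nra|]. apply pow_le. nra.
  + apply (stability_factor_bound _ d (L h) (sigma h) (rho h)); auto.
Qed.
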